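(* Assume that $c<1/2$, that there is $L>0$ such that $\|\nabla f(u)-\nabla f(v)\|\le L\|u-v\|$ for all $u,v\in\mathbb{R}^n$, and that $f$ is convex. Let $x_0\in\mathbb{R}^n$ be any initial point, let $\Omega$ be the set of optimal solutions of $\min_{x\in\mathbb{R}^n}f(x)$, and assume that $$R_0=\max_{x:\,f(x)\le f(x_0)}\ \min_{x^*\in\Omega}\|x-x^*\|$$ is finite. Let $(x_k)_{k\ge0}$ be the iterates generated from $x_0$ by the finite-difference algorithm described in the context. Put $$K:=\max\left(\frac{4\sqrt d\,\mathcal{C}n}{1-\epsilon},\ \frac{6\,\mathcal{C}nm^2}{d}\left(\frac{M_2}{M_1c}+1\right)\right)L,\qquad \bar\alpha:=\min\left(1,\frac{2\beta(1-2c)}{mM_2L}\right).$$ Then for any $\epsilon\in(0,1)$ with $p(\epsilon)>0$, any finite-difference precision $\varepsilon>0$ and all $k\ge 0$, $$\mathbb{E}[f(x_k)-f^*]\le\frac{L\,\mathcal{C}^2n^2R_0^2}{2\mathcal{C}^2n^2+L\,c\,M_1\,p(\epsilon)(1-\epsilon)^2d^2\,k\,\bar\alpha}+2R_0K\varepsilon.$$ If furthermore the precision is decreased along the iterations, with precision $\varepsilon_k$ used at iteration $k$ such that $\varepsilon_k\le O(1/k)$, then $\mathbb{E}[f(x_k)-f^*]=O(1/k)$.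
   Context: Notation: $\epsilon\in(0,1)$ (distortion of random projections) and $\varepsilon>0$ (finite-difference precision) are two different quantities. Setting. $f:\mathbb{R}^n\to\mathbb{R}$ is of class $C^2$, and $f^*\in\mathbb{R}$ is the optimal value of $\min_{x\in\mathbb{R}^n}f(x)$. $\|\cdot\|$ is the Euclidean norm for vectors and the operator norm for matrices. $d,m$ are positive integers, much smaller than $n$, with $m$ even. Parameters: $\beta,c\in(0,1)$ and $0<M_1\le M_2$. For a matrix $A\in\mathbb{R}^{n\times r}$, with $e_1,\dots,e_r$ the canonical basis of $\mathbb{R}^r$, define $\nabla_{A,\varepsilon}f(x)\in\mathbb{R}^r$ by $$\nabla_{A,\varepsilon}f(x)_i=\frac{f(x+\varepsilon Ae_i)-f(x-\varepsilon Ae_i)}{2\varepsilon},\qquad 1\le i\le r.$$ Finite-difference algorithm. Input: a deterministic $x_0\in\mathbb{R}^n$, a symmetric matrix $H_0\in\mathbb{R}^{m\times m}$ with $M_1I_m\preceq H_0\preceq M_2I_m$, and an initial $n\times m$ matrix with normalized columns. For $k=0,1,2,\dots$ (with precision $\varepsilon$, replaced by $\varepsilon_k$ at iteration $k$ when the precision varies): 1. Sample $Q_k\in\mathbb{R}^{n\times d}$ with independent $N(0,1)$ entries, independent of everything generated before. 2. $P_k\in\mathbb{R}^{n\times m}$ has columns, in order for $j=k-\frac m2+1,\dots,k$, $\frac{x_j}{\|x_j\|}$ and $\frac{Q_j\nabla_{Q_j,\varepsilon}f(x_j)}{\|Q_j\nabla_{Q_j,\varepsilon}f(x_j)\|}$,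 where any column with zero denominator is replaced by the zero vector. At each iteration the first two columns are dropped and the two new columns appended at the end; for early iterations, columns with negative indices are taken from the initial matrix. 3. $\mathbf{d}_k:=-H_k\nabla_{P_k,\varepsilon}f(x_k)$. 4. $\alpha_k:=\beta^i$, with $i\in\{0,1,2,\dots\}$ the smallest integer such that $f(x_k+\alpha_kP_k\mathbf{d}_k)\le f(x_k)+c\,\alpha_k\nabla_{P_k,\varepsilon}f(x_k)^\top\mathbf{d}_k$ (the line search is understood to terminate at every iteration). 5. $x_{k+1}:=x_k+\alpha_kP_k\mathbf{d}_k$. 6. With $s=\alpha_k\mathbf{d}_k$ and $y=\nabla_{P_k,\varepsilon}f(x_k+\alpha_kP_k\mathbf{d}_k)-\nabla_{P_k,\varepsilon}f(x_k)$, set $\tilde H_{k+1}:=\left(I-\frac{sy^\top}{s^\top y}\right)H_k\left(I-\frac{ys^\top}{s^\top y}\right)+\frac{ss^\top}{s^\top y}$. 7. $H_{k+1}$ is obtained from $\tilde H_{k+1}$ by replacing its eigenvalues larger than $M_2$ by $M_2$ and those smaller than $M_1$ by $M_1$, so $M_1I_m\preceq H_{k+1}\preceq M_2I_m$. (If $s^\top y=0$, $H_{k+1}$ is any symmetric matrix determined by the history and satisfying these bounds.) Constants. $\mathcal{C}_0>0$ and $\mathcal{C}>0$ are constants such that, for a random $Q\in\mathbb{R}^{n\times d}$ with independent $N(0,1)$ entries: (i) for every $\epsilon\in(0,1)$ and $x\in\mathbb{R}^n$, $(1-\epsilon)\|x\|^2\le\|\frac1{\sqrt d}Q^\top x\|^2\le(1+\epsilon)\|x\|^2$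 with probability at least $1-2e^{-\mathcal{C}_0\epsilon^2d}$; (ii) $\frac1d\|QQ^\top\|\le\mathcal{C}\frac nd$ with probability at least $1-2e^{-d}$. Set $p(\epsilon):=1-(2e^{-\mathcal{C}_0\epsilon^2d}+2e^{-d})$. Expectations are over all the matrices $Q_k$. *)

(* Defs.v *)
From HB Require Import structures.
From mathcomp Require Export all_boot all_order all_algebra.
From mathcomp Require Export all_classical all_reals all_analysis.

Set Implicit Arguments.
Unset Strict Implicit.
Unset Printing Implicit Defensive.

Export Order.TTheory GRing.Theory Num.Theory.
Export numFieldNormedType.Exports.

#[global] Open Scope classical_set_scope.
#[global] Open Scope ring_scope.

(* The library norm on matrices is the sup norm; the Euclidean and operator
   norms are therefore defined here. *)
Section euclidean.
Context {R : realType}.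

Definition dotv {n} (u v : 'cV[R]_n) : R := (u^T *m v) 0 0.

Definition enorm {n} (v : 'cV[R]_n) : R := Num.sqrt (dotv v v).

Definition opnorm {p q} (A : 'M[R]_(p, q)) : R :=
  sup [set enorm (A *m v) | v in [set v : 'cV[R]_q | enorm v <= 1]].

(* Since 0^-1 = 0, the zero vector is sent to itself. *)
Definition normalize {n} (v : 'cV[R]_n) : 'cV[R]_n := (enorm v)^-1 *: v.

Definition psd {m} (A : 'M[R]_m) : Prop :=
  A^T = A /\ forall v : 'cV[R]_m, 0 <= dotv v (A *m v).

Definition spectral_bounds {m} (M1 M2 : R) (A : 'M[R]_m) : Prop :=
  [/\ A^T = A, psd (A - M1%:M) & psd (M2%:M - A)].

End euclidean.

Section smoothness.
Context {R : realType} {n : nat}.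
Implicit Type f : 'cV[R]_n -> R.

Definition partial (i : 'I_n) f : 'cV[R]_n -> R := 'D_(delta_mx i 0) f.

Definition grad f (x : 'cV[R]_n) : 'cV[R]_n := \col_i partial i f x.

Definition class_C2 f : Prop :=
  (forall i, (forall x, derivable f x (delta_mx i 0)) /\
             continuous (partial i f)) /\
  (forall i j, (forall x, derivable (partial i f) x (delta_mx j 0)) /\
               continuous (partial j (partial i f))).

Definition optimal_value f : \bar R := ereal_inf [set (f x)%:E | x in setT].

Definition argmin f : set 'cV[R]_n := [set x | forall y, f x <= f y].

(* The supremum, in the extended reals, of the distance to the set of
   minimisers over the sublevel set of x0. It is +oo if there is no minimiser. *)
Definition sublevel_radius f (x0 : 'cV[R]_n) : \bar R :=
  ereal_sup [set ereal_inf [set (enorm (x - y))%:E | y in argmin f]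
            | x in [set x | f x <= f x0]].

End smoothness.

Section probability.
Context {R : realType} {disp : measure_display} {T : measurableType disp}.
Variable P : probability T R.

Definition standard_normal (X : T -> R) : Prop :=
  measurable_fun setT X /\
  forall B : set R, measurable B -> P (X @^-1` B) = normal_prob 0 1 B.

Definition mutually_independent {I : eqType} (X : I -> T -> R) : Prop :=
  forall (s : seq I) (B : I -> set R), uniq s -> (forall i, measurable (B i)) ->
  P (\bigcap_(i in [set` s]) X i @^-1` B i) =
  (\prod_(i <- s) P (X i @^-1` B i))%E.

Definition gaussian_mx {n d} (Q : T -> 'M[R]_(n, d)) : Prop :=
  let X := fun (ij : 'I_n * 'I_d) w => Q w ij.1 ij.2 in
  (forall ij, standard_normal (X ij)) /\ mutually_independent X.

(* All entries of all the matrices are independent; in particular Q k is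
   independent of Q 0, ..., Q (k - 1). *)
Definition gaussian_mx_seq {n d} (Q : nat -> T -> 'M[R]_(n, d)) : Prop :=
  let X := fun (kij : nat * ('I_n * 'I_d)) w => Q kij.1 w kij.2.1 kij.2.2 in
  (forall kij, standard_normal (X kij)) /\ mutually_independent X.

(* The sigma-algebra generated by Q 0, ..., Q k. *)
Definition history {n d} (Q : nat -> T -> 'M[R]_(n, d)) (k : nat)
    : set (set T) :=
  <<s \bigcup_(lij in [set lij : nat * ('I_n * 'I_d) | (lij.1 <= k)%N])
        preimage_set_system setT
          (fun w => Q lij.1 w lij.2.1 lij.2.2) measurable >>.

(* W k is determined by Q 0, ..., Q k. *)
Definition adapted {n d p q} (Q : nat -> T -> 'M[R]_(n, d))
    (W : nat -> T -> 'M[R]_(p, q)) : Prop :=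
  forall k i j (B : set R), measurable B ->
    history Q k ((fun w => W k w i j) @^-1` B).

(* The two properties depend only on the law of Q, so restricting the
   quantification to matrices defined on T is harmless as soon as T carries
   one Gaussian matrix. *)
Definition concentration_constants (n d : nat) (C0 C : R) : Prop :=
  forall Q : T -> 'M[R]_(n, d), gaussian_mx Q ->
  (forall (eps : R) (x : 'cV[R]_n), 0 < eps < 1 ->
    ((1 - 2 * expR (- (C0 * eps ^+ 2 * d%:R)))%:E <=
     P [set w | ((1 - eps) * enorm x ^+ 2
                 <= enorm ((Num.sqrt d%:R)^-1 *: ((Q w)^T *m x)) ^+ 2
                 <= (1 + eps) * enorm x ^+ 2)%R])%E) /\
  ((1 - 2 * expR (- d%:R))%:E <=
   P [set w | (d%:R^-1 * opnorm (Q w *m (Q w)^T) <= C * (n%:R / d%:R))%R])%E.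

End probability.

Definition success_prob {R : realType} (d : nat) (C0 eps : R) : R :=
  1 - (2 * expR (- (C0 * eps ^+ 2 * d%:R)) + 2 * expR (- d%:R)).

Section algorithm.
Context {R : realType} {n d m : nat}.
Variable f : 'cV[R]_n -> R.

Definition fdgrad {r} (e : R) (A : 'M[R]_(n, r)) (x : 'cV[R]_n) : 'cV[R]_r :=
  \col_i ((f (x + e *: (A *m delta_mx i 0)) - f (x - e *: (A *m delta_mx i 0)))
          / (2 * e)).

(* Drops the first two columns of A and appends u and v, in this order. *)
Definition push_cols (A : 'M[R]_(n, m)) (u v : 'cV[R]_n) : 'M[R]_(n, m) :=
  \matrix_(i, j)
    if insub j.+2 : option 'I_m is Some j2 then A i j2
    else if j.+2 == m then u i 0 else v i 0.

(* The columns attached to step k are computed with the precision e k, and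
   kept unchanged as long as they stay in the window. *)
Fixpoint proj_mx (e : nat -> R) (Pinit : 'M[R]_(n, m))
    (Q : nat -> 'M[R]_(n, d)) (x : nat -> 'cV[R]_n) (k : nat) : 'M[R]_(n, m) :=
  push_cols (if k is k'.+1 then proj_mx e Pinit Q x k' else Pinit)
    (normalize (x k)) (normalize (Q k *m fdgrad (e k) (Q k) (x k))).

Definition bfgs_update (H : 'M[R]_m) (s y : 'cV[R]_m) : 'M[R]_m :=
  (1%:M - (dotv s y)^-1 *: (s *m y^T)) *m H
    *m (1%:M - (dotv s y)^-1 *: (y *m s^T))
  + (dotv s y)^-1 *: (s *m s^T).

(* B is the symmetric matrix A with its eigenvalues clipped to [M1, M2]. *)
Definition eigen_clip (M1 M2 : R) (A B : 'M[R]_m) : Prop :=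
  exists (U : 'M[R]_m) (v : 'rV[R]_m),
    [/\ U^T *m U = 1%:M, A = U *m diag_mx v *m U^T &
        B = U *m diag_mx (map_mx (fun t => Num.min M2 (Num.max M1 t)) v)
              *m U^T].

Definition armijo (c : R) (x : 'cV[R]_n) (A : 'M[R]_(n, m)) (g dir : 'cV[R]_m)
    (a : R) : Prop :=
  f (x + a *: (A *m dir)) <= f x + c * a * dotv g dir.

(* One iteration, from (x, H) to (x', H'), with precision e and projection A;
   W is the matrix used when the curvature s^T y vanishes. The existence of i
   expresses that the line search terminates. *)
Definition fd_step (beta c M1 M2 e : R) (A : 'M[R]_(n, m)) (W : 'M[R]_m)
    (x : 'cV[R]_n) (H : 'M[R]_m) (x' : 'cV[R]_n) (H' : 'M[R]_m) : Prop :=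
  let g := fdgrad e A x in
  let dir := - (H *m g) in
  exists i : nat,
    let a := beta ^+ i in
    let s := a *: dir in
    let y := fdgrad e A x' - g in
    [/\ armijo c x A g dir a,
        forall l, (l < i)%N -> ~ armijo c x A g dir (beta ^+ l),
        x' = x + a *: (A *m dir) &
        if dotv s y == 0 then H' = W
        else eigen_clip M1 M2 (bfgs_update H s y) H'].

Definition fd_path (beta c M1 M2 : R) (e : nat -> R) (x0 : 'cV[R]_n)
    (H0 : 'M[R]_m) (Pinit : 'M[R]_(n, m)) (Q : nat -> 'M[R]_(n, d))
    (W : nat -> 'M[R]_m) (x : nat -> 'cV[R]_n) (H : nat -> 'M[R]_m) : Prop :=
  [/\ x 0%N = x0, H 0%N = H0 &
      forall k, fd_step beta c M1 M2 (e k) (proj_mx e Pinit Q x k) (W k)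
                  (x k) (H k) (x k.+1) (H k.+1)].

(* The algorithm as a stochastic process: x and H are the iterates driven by
   the random matrices Q. The choice W k of H_{k+1} when s^T y = 0 may use
   Q 0, ..., Q k. *)
Definition fd_run {disp : measure_display} {T : measurableType disp}
    (beta c M1 M2 : R) (e : nat -> R) (x0 : 'cV[R]_n)
    (H0 : 'M[R]_m) (Pinit : 'M[R]_(n, m)) (Q : nat -> T -> 'M[R]_(n, d))
    (x : nat -> T -> 'cV[R]_n) (H : nat -> T -> 'M[R]_m) : Prop :=
  exists W : nat -> T -> 'M[R]_m,
    [/\ adapted Q W,
        forall k w, spectral_bounds M1 M2 (W k w) &
        forall w, fd_path beta c M1 M2 e x0 H0 Pinit
                    (Q ^~ w) (W ^~ w) (x ^~ w) (H ^~ w)].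

End algorithm.

(* Main.v *)
From HB Require Import structures.
Require Import Defs.
From mathcomp Require Import measurable_realfun ring lra.

Set Implicit Arguments.
Unset Strict Implicit.
Unset Printing Implicit Defensive.

(** Write [D k := f (x k) - fstar], [b k := 2 R0 K e_k], [s := C n] and
    [q := (1 - eps) d / s].  The theorem rests on one inequality: the line
    search never increases [f], and when the sketch [Q k] is [successful] for
    [grad f (x k)],
      [D (k + 1) <= D k - kap (D k - b k)_+ ^ 2],
    where [kap := c abar M1 q ^ 2 / R0 ^ 2].

    Deterministic part ([fd_step_decrease]).  Let [g] be the finite-difference
    gradient in the window, [gam := <g, H g>], and [r] the part of the
    directional derivative due to [g] not being exact.  The descent lemma
    ([grad_taylor]) shows that, when [r <= gam / 2], a trial step of length at
    most [2 (1 - 2 c) (1 - r / gam) / (m M2 L)] is accepted, so backtracking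
    decreases [f] by at least [c abar (gam - r)] ([line_search_step_lb]), and
    [gam - r >= M1 (|g| - mu) ^ 2] with [mu] proportional to the precision
    ([curvature_lb]).  The norm [|g|] is at least its entry along the sketched
    direction [Q h / |Q h|], where [h] approximates [Q^T grad f];
    since [|Q h| <= sqrt s |h|], that entry is at least [sqrt q |grad f|] up to
    errors proportional to the precision ([sketch_direction]).  All these
    errors, [mu] included, amount to at most [2 sqrt q K e]
    ([precision_constant_lb]), hence [|g| - mu >= sqrt q (|grad f| - 2 K e)].
    The constant [K] achieves this because [s] cannot be too small: an entry of
    a Gaussian matrix has a density bounded by [1 / 2] ([gram_constant_lb]).
    Finally convexity gives [D k <= R0 |grad f (x k)|] ([gap_le_grad]).

    Probabilistic part ([expected_gap_decrease]).  The iterate [x k] is a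
    function of [Q 0], ..., [Q (k - 1)], of which [Q k] is independent; so,
    given the past, success has probability at least [p := success_prob d C0
    eps].  This needs the measurability of the iterates, where the only
    delicate operation is the clipping of eigenvalues; it is the projection
    onto a convex set, therefore Lipschitz ([eigen_clip_lipschitz]).
    Independence of the generated sigma-algebras turns the law of
    [w |-> (w, w)] into a product measure, and Tonelli's theorem integrates
    over the current sketch with the past frozen ([indep_integral_ge]).
    With Jensen's inequality, the numbers [u k := E (D k)] satisfy
      [u (k + 1) <= u k - kap p (u k - b k)_+ ^ 2].

    Scalar part.  If [b] is constant, the excess [(u k - b)_+] has an inverse
    that grows by [kap p] at each step, starting from at least
    [2 / (L R0 ^ 2)] ([recursion_constant_error]).  If [b k = O(1 / k)], an
    induction gives [u k = O(1 / k)] ([recursion_decaying_error]).  When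
    [R0 = 0] every iterate is optimal. *)


(** * Euclidean geometry *)

Section dot.
Context {R : realType}.
Implicit Types n p q : nat.

Lemma le_of_sqr_le (a b : R) : 0 <= b -> a ^+ 2 <= b ^+ 2 -> a <= b.
Proof. by move=> b0 h; apply: contraLR h; rewrite -!ltNge !expr2; nra. Qed.

Lemma dotvE n (u v : 'cV[R]_n) : dotv u v = \sum_i u i 0 * v i 0.
Proof. by rewrite /dotv mxE; apply: eq_bigr => i _; rewrite mxE. Qed.

Lemma dotvC n (u v : 'cV[R]_n) : dotv u v = dotv v u.
Proof. by rewrite !dotvE; apply: eq_bigr => i _; rewrite mulrC. Qed.

Lemma dotvDr n (u v w : 'cV[R]_n) : dotv u (v + w) = dotv u v + dotv u w.
Proof. by rewrite /dotv mulmxDr mxE. Qed.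

Lemma dotvDl n (u v w : 'cV[R]_n) : dotv (v + w) u = dotv v u + dotv w u.
Proof. by rewrite !(dotvC _ u) dotvDr. Qed.

Lemma dotvZr n a (u v : 'cV[R]_n) : dotv u (a *: v) = a * dotv u v.
Proof. by rewrite /dotv -scalemxAr mxE. Qed.

Lemma dotvZl n a (u v : 'cV[R]_n) : dotv (a *: u) v = a * dotv u v.
Proof. by rewrite dotvC dotvZr dotvC. Qed.

Lemma dotvNr n (u v : 'cV[R]_n) : dotv u (- v) = - dotv u v.
Proof. by rewrite -scaleN1r dotvZr mulN1r. Qed.

Lemma dotvNl n (u v : 'cV[R]_n) : dotv (- u) v = - dotv u v.
Proof. by rewrite dotvC dotvNr dotvC. Qed.

Lemma dotvBr n (u v w : 'cV[R]_n) : dotv u (v - w) = dotv u v - dotv u w.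
Proof. by rewrite dotvDr dotvNr. Qed.

Lemma dotvBl n (u v w : 'cV[R]_n) : dotv (v - w) u = dotv v u - dotv w u.
Proof. by rewrite dotvDl dotvNl. Qed.

Lemma dotv0r n (u : 'cV[R]_n) : dotv u 0 = 0.
Proof. by rewrite /dotv mulmx0 mxE. Qed.

Lemma dotv_adj p q (A : 'M[R]_(p, q)) (u : 'cV[R]_p) (v : 'cV[R]_q) :
  dotv u (A *m v) = dotv (A^T *m u) v.
Proof. by rewrite /dotv trmx_mul trmxK mulmxA. Qed.

Lemma dotv_delta n i (v : 'cV[R]_n) : dotv v (delta_mx i 0) = v i 0.
Proof.
rewrite dotvE (bigD1 i) //= !mxE !eqxx mulr1 big1 ?addr0 // => j ji.
by rewrite mxE (negbTE ji) mulr0.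
Qed.

Lemma dotvv_ge0 n (u : 'cV[R]_n) : 0 <= dotv u u.
Proof. by rewrite dotvE sumr_ge0 // => i _; rewrite -expr2 sqr_ge0. Qed.

Lemma sqr_enorm n (u : 'cV[R]_n) : enorm u ^+ 2 = dotv u u.
Proof. by rewrite sqr_sqrtr // dotvv_ge0. Qed.

Lemma enorm_ge0 n (u : 'cV[R]_n) : 0 <= enorm u.
Proof. exact: sqrtr_ge0. Qed.

Lemma enorm_eq0 n (u : 'cV[R]_n) : enorm u = 0 -> u = 0.
Proof.
move=> u0; have /eqP : dotv u u = 0 by rewrite -sqr_enorm u0 expr0n.
rewrite dotvE psumr_eq0; last by move=> i _; rewrite -expr2 sqr_ge0.
move=> /allP h; apply/colP => i; rewrite mxE.
by have /eqP/eqP := h i (mem_index_enum i); rewrite /= mulf_eq0 orbb => /eqP.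
Qed.

Lemma enorm0 n : enorm (0 : 'cV[R]_n) = 0.
Proof. by rewrite /enorm dotv0r sqrtr0. Qed.

Lemma enormZ n a (u : 'cV[R]_n) : enorm (a *: u) = `|a| * enorm u.
Proof.
by rewrite /enorm dotvZl dotvZr mulrA -expr2 sqrtrM ?sqr_ge0 // sqrtr_sqr.
Qed.

Lemma enormN n (u : 'cV[R]_n) : enorm (- u) = enorm u.
Proof. by rewrite -scaleN1r enormZ normrN1 mul1r. Qed.

(** The quadratic form of a positive semidefinite matrix is nonnegative along
    the line through [u] and [v], so its discriminant is nonpositive. *)
Lemma psd_cauchy_schwarz n (A : 'M[R]_n) (u v : 'cV[R]_n) : psd A ->
  dotv u (A *m v) ^+ 2 <= dotv u (A *m u) * dotv v (A *m v).
Proof.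
move=> [As Ap]; set a := dotv u (A *m u); set b := dotv u (A *m v).
set c := dotv v (A *m v).
have bC : dotv v (A *m u) = b by rewrite dotv_adj As dotvC.
have pos t : 0 <= a + 2 * t * b + t ^+ 2 * c.
  have := Ap (u + t *: v).
  rewrite mulmxDr -scalemxAr !dotvDl !dotvDr !dotvZl !dotvZr bC -/a -/b -/c.
  by congr (_ <= _); ring.
have a0 : 0 <= a by exact: Ap.
have c0 : 0 <= c by exact: Ap.
have [c_eq0|cn0] := eqVneq c 0.
  have [->|bn0] := eqVneq b 0; first by rewrite expr0n mulr_ge0.
  have := pos (- (a + 1) / (2 * b)).
  rewrite c_eq0 (_ : _ + _ = -1); first by lra.
  by field.
have cp : 0 < c by rewrite lt_def cn0.
have := pos (- b / c).
rewrite (_ : _ + _ = (a * c - b ^+ 2) / c); last by field.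
by rewrite pmulr_lge0 ?invr_gt0 // subr_ge0.
Qed.

Lemma psd1 n : psd (1%:M : 'M[R]_n).
Proof. by split; [rewrite trmx1|move=> v; rewrite mul1mx dotvv_ge0]. Qed.

Lemma cauchy_schwarz n (u v : 'cV[R]_n) : `|dotv u v| <= enorm u * enorm v.
Proof.
rewrite -ler_sqr ?nnegrE ?mulr_ge0 ?enorm_ge0 // exprMn !sqr_enorm.
by rewrite real_normK ?num_real //; have := psd_cauchy_schwarz u v (psd1 n);
   rewrite !mul1mx.
Qed.

Lemma dotv_le n (u v : 'cV[R]_n) : dotv u v <= enorm u * enorm v.
Proof. exact: le_trans (ler_norm _) (cauchy_schwarz u v). Qed.

Lemma ler_enormD n (u v : 'cV[R]_n) : enorm (u + v) <= enorm u + enorm v.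
Proof.
rewrite -ler_sqr ?nnegrE ?addr_ge0 ?enorm_ge0 // sqrrD !sqr_enorm.
rewrite dotvDl !dotvDr (dotvC v u); have := dotv_le u v; lra.
Qed.

Lemma ler_enormB n (u v : 'cV[R]_n) : enorm u - enorm v <= enorm (u - v).
Proof. by rewrite lerBlDr -{1}(subrK v u) ler_enormD. Qed.

Lemma ler_entry_enorm n (u : 'cV[R]_n) i : `|u i 0| <= enorm u.
Proof.
rewrite -ler_sqr ?nnegrE ?enorm_ge0 // sqr_enorm real_normK ?num_real //.
rewrite dotvE (bigD1 i) //= -expr2 lerDl sumr_ge0 // => j _.
by rewrite -expr2 sqr_ge0.
Qed.

Lemma ler_entry_mx_norm p q (A : 'M[R]_(p, q)) i j : `|A i j| <= `|A|.
Proof. by rewrite [X in _ <= X]mx_normrE (le_bigmax _ _ (i, j)). Qed.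

Lemma ler_enorm_unif n (u : 'cV[R]_n) a : 0 <= a ->
  (forall i, `|u i 0| <= a) -> enorm u <= Num.sqrt n%:R * a.
Proof.
move=> a0 ua; rewrite -ler_sqr ?nnegrE ?mulr_ge0 ?sqrtr_ge0 ?enorm_ge0 //.
rewrite sqr_enorm dotvE exprMn sqr_sqrtr ?ler0n //.
rewrite (@le_trans _ _ (\sum_(i < n) a ^+ 2)) //; last first.
  by rewrite sumr_const card_ord mulr_natl.
apply: ler_sum => i _; rewrite -expr2 -[X in X <= _]real_normK ?num_real //.
by rewrite ler_sqr ?nnegrE // normr_ge0.
Qed.

(** Cauchy--Schwarz between the coefficients of [v] and the columns of [A]. *)
Lemma enorm_mulmx_le p q (A : 'M[R]_(p, q)) (v : 'cV[R]_q) a : 0 <= a ->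
  (forall j, enorm (col j A) <= a) ->
  enorm (A *m v) <= Num.sqrt q%:R * a * enorm v.
Proof.
move=> a0 Aa.
have [z|nz] := eqVneq (enorm (A *m v)) 0.
  by rewrite z !mulr_ge0 ?sqrtr_ge0 ?enorm_ge0.
have pz : 0 < enorm (A *m v) by rewrite lt_def nz enorm_ge0.
rewrite -(ler_pM2l pz) -expr2 sqr_enorm dotv_adj (le_trans (dotv_le _ _)) //.
rewrite mulrA ler_wpM2r ?enorm_ge0 // (@le_trans _ _ (Num.sqrt q%:R *
  (a * enorm (A *m v)))) //; last by rewrite le_eqVlt; apply/orP; left;
  apply/eqP; ring.
apply: ler_enorm_unif => [|i]; first by rewrite mulr_ge0 ?enorm_ge0.
have -> : (A^T *m (A *m v)) i 0 = dotv (col i A) (A *m v).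
  rewrite dotvE mxE; apply: eq_bigr => j _; rewrite !mxE; congr (_ * _).
by rewrite (le_trans (cauchy_schwarz _ _)) // ler_wpM2r ?enorm_ge0.
Qed.

Lemma enorm_normalize_le1 n (v : 'cV[R]_n) : enorm (normalize v) <= 1.
Proof.
rewrite enormZ ger0_norm ?invr_ge0 ?enorm_ge0 //.
have [->|nz] := eqVneq (enorm v) 0; first by rewrite mulr0 ler01.
by rewrite mulVf.
Qed.

Lemma opnorm_ubound p q (A : 'M[R]_(p, q)) :
  has_ubound [set enorm (A *m v) | v in [set v : 'cV[R]_q | enorm v <= 1]].
Proof.
pose a := \sum_j enorm (col j A).
have Aa j : enorm (col j A) <= a.
  by rewrite /a (bigD1 j) //= lerDl sumr_ge0 // => i _; exact: enorm_ge0.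
have a0 : 0 <= a by rewrite sumr_ge0 // => i _; exact: enorm_ge0.
exists (Num.sqrt q%:R * a) => _ [w w1 <-].
apply: le_trans (enorm_mulmx_le _ a0 Aa) _.
by rewrite ler_piMr // mulr_ge0 ?sqrtr_ge0.
Qed.

Lemma opnorm_ge0 p q (A : 'M[R]_(p, q)) : 0 <= opnorm A.
Proof.
apply: (ub_le_sup (opnorm_ubound A)); exists 0 => /=.
  by rewrite enorm0.
by rewrite mulmx0 enorm0.
Qed.

Lemma enorm_opnorm_le p q (A : 'M[R]_(p, q)) (v : 'cV[R]_q) :
  enorm (A *m v) <= opnorm A * enorm v.
Proof.
have [/enorm_eq0 ->|nz] := eqVneq (enorm v) 0.
  by rewrite mulmx0 !enorm0 mulr0.
have pv : 0 < enorm v by rewrite lt_def nz enorm_ge0.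
rewrite -ler_pdivrMr // mulrC -[(enorm v)^-1]ger0_norm ?invr_ge0 ?enorm_ge0 //.
rewrite -enormZ scalemxAr; apply: (ub_le_sup (opnorm_ubound A)).
by exists ((enorm v)^-1 *: v) => //; exact: enorm_normalize_le1.
Qed.

Lemma opnorm_le p q (A : 'M[R]_(p, q)) a :
  (forall v, enorm (A *m v) <= a * enorm v) -> 0 <= a -> opnorm A <= a.
Proof.
move=> h a0; apply: ge_sup.
  by exists (enorm (A *m 0)), 0 => //=; rewrite enorm0 ler01.
by move=> _ [v v1 <-]; rewrite (le_trans (h v)) // ler_piMr.
Qed.

Lemma enorm_tr_mulmx_gram p q (A : 'M[R]_(p, q)) s (y : 'cV[R]_p) :
  opnorm (A *m A^T) <= s -> enorm (A^T *m y) ^+ 2 <= s * enorm y ^+ 2.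
Proof.
move=> As; rewrite sqr_enorm -dotv_adj mulmxA (le_trans (dotv_le _ _)) //.
rewrite expr2 mulrA (mulrC s) -mulrA ler_wpM2l ?enorm_ge0 //.
by rewrite (le_trans (enorm_opnorm_le _ _)) // ler_wpM2r ?enorm_ge0.
Qed.

Lemma enorm_mulmx_gram p q (A : 'M[R]_(p, q)) s (v : 'cV[R]_q) :
  0 <= s -> opnorm (A *m A^T) <= s -> enorm (A *m v) <= Num.sqrt s * enorm v.
Proof.
move=> s0 As.
have [z|nz] := eqVneq (enorm (A *m v)) 0.
  by rewrite z mulr_ge0 ?sqrtr_ge0 ?enorm_ge0.
have pz : 0 < enorm (A *m v) by rewrite lt_def nz enorm_ge0.
rewrite -(ler_pM2l pz) -expr2 sqr_enorm dotv_adj (le_trans (dotv_le _ _)) //.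
rewrite mulrA ler_wpM2r ?enorm_ge0 //; apply: le_of_sqr_le.
  by rewrite mulr_ge0 ?sqrtr_ge0 ?enorm_ge0.
by rewrite exprMn (sqr_sqrtr s0) mulrC; exact: enorm_tr_mulmx_gram.
Qed.

Lemma spectral_bounds_ge n M1 M2 (H : 'M[R]_n) v : spectral_bounds M1 M2 H ->
  M1 * dotv v v <= dotv v (H *m v).
Proof.
move=> [_ [_ /(_ v) + ] _].
by rewrite mulmxBl mul_scalar_mx dotvBr dotvZr subr_ge0.
Qed.

Lemma spectral_bounds_le n M1 M2 (H : 'M[R]_n) v : spectral_bounds M1 M2 H ->
  dotv v (H *m v) <= M2 * dotv v v.
Proof.
move=> [_ _ [_ /(_ v)]].
by rewrite mulmxBl mul_scalar_mx dotvBr dotvZr subr_ge0.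
Qed.

(** Cauchy--Schwarz for the form of [H] between [v] and [H v]; this is
    [H ^ 2 <= M2 H] without taking a square root of [H]. *)
Lemma spectral_bounds_sqr n M1 M2 (H : 'M[R]_n) v : 0 <= M1 ->
  spectral_bounds M1 M2 H ->
  enorm (H *m v) ^+ 2 <= M2 * dotv v (H *m v).
Proof.
move=> M10 sH; have [Hs _ _] := sH; rewrite sqr_enorm.
have pH : psd H.
  split=> // u; apply: le_trans (spectral_bounds_ge u sH).
  by rewrite mulr_ge0 ?dotvv_ge0.
have [z|nz] := eqVneq (dotv (H *m v) (H *m v)) 0.
  have -> : H *m v = 0 by apply: enorm_eq0; rewrite /enorm z sqrtr0.
  by rewrite !dotv0r mulr0.
have pz : 0 < dotv (H *m v) (H *m v) by rewrite lt_def nz dotvv_ge0.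
rewrite -(ler_pM2l pz) -expr2 mulrA.
have e : dotv (H *m v) (H *m v) = dotv v (H *m (H *m v)).
  by rewrite [RHS]dotv_adj Hs.
rewrite {1}e (le_trans (psd_cauchy_schwarz _ _ pH)) //.
rewrite mulrC ler_wpM2r //; first exact: pH.2.
by rewrite mulrC; exact: spectral_bounds_le sH.
Qed.

End dot.

(** * Smooth convex functions *)

Section one_variable.
Context {R : realType}.
Implicit Types g : R -> R.

Lemma taylor1_ub g (dg : R -> R) (l : R) : (forall s : R, is_derive s 1 g (dg s)) ->
  (forall s, 0 < s < 1 -> dg s - dg 0 <= l * s) ->
  g 1 <= g 0 + dg 0 + l / 2.
Proof.
move=> hg hl; pose h := fun s : R => g s - (dg 0 * s + l / 2 * (s * s)).
have dh (s : R) : is_derive s 1 h (dg s - (dg 0 + l * s)).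
  rewrite /h; apply: is_deriveB; apply: is_derive_eq.
  rewrite /GRing.scale /=; lra.
have ch : {within `[(0:R), 1], continuous h}.
  apply: derivable_within_continuous => s _.
  by have [] := dh s.
have [c c01] := MVT ltr01 (fun s _ => dh s) ch.
rewrite /h; move: c01; rewrite in_itv /= => /hl; lra.
Qed.

Lemma taylor1_abs g (dg : R -> R) (l : R) :
  (forall s : R, is_derive s 1 g (dg s)) ->
  (forall s, 0 < s < 1 -> `|dg s - dg 0| <= l * s) ->
  `|g 1 - g 0 - dg 0| <= l / 2.
Proof.
move=> hg hl.
have up := taylor1_ub hg (fun s h => le_trans (ler_norm _) (hl s h)).
have := @taylor1_ub _ _ l (fun s => is_deriveN (hg s)).
rewrite !opprfctE => lo; rewrite ler_norml; apply/andP; split; last by lra.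
suff /lo : forall s : R, 0 < s < 1 -> - dg s - - dg 0 <= l * s by lra.
by move=> s /hl; rewrite ler_norml; lra.
Qed.

(** Used with the crude quadratic error of [grad_taylor_crude], which thereby
    yields the derivative of [f] along every line. *)
Lemma is_derive_quadratic g (t D C : R) :
  (forall h, `|g (t + h) - g t - h * D| <= C * h ^+ 2) -> is_derive t 1 g D.
Proof.
move=> hg.
have cv : h^-1 *: ((g \o shift t) (h *: 1) - g t) @[h --> 0^'] --> D.
  apply/cvgrPdist_le => /= e e0.
  have C0 : 0 <= C by have := hg 1; rewrite expr1n mulr1; exact: le_trans.
  have C1 : 0 < C + 1 by lra.
  near=> h.
  have h0 : h != 0 by near: h; exact: nbhs_dnbhs_neq.
  have hs : `|h| < e / (C + 1).
    near: h; apply: dnbhs0_lt; exact: divr_gt0.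
  rewrite /= /GRing.scale /= mulr1 (addrC h t).
  rewrite (_ : D - _ = - (h^-1 * (g (t + h) - g t - h * D))); last by field.
  rewrite normrN normrM normfV ler_pdivrMl ?normr_gt0 //.
  rewrite (le_trans (hg h)) // -[h ^+ 2]real_normK ?num_real // expr2 mulrCA.
  rewrite ler_wpM2l // (le_trans _ (ltW (_ : (C + 1) * `|h| < e))) //.
    by rewrite ler_wpM2r //; lra.
  by rewrite mulrC -ltr_pdivlMr.
split; last exact: cvg_lim cv.
by apply/cvg_ex; exists D.
Unshelve. all: by end_near. Qed.

End one_variable.

Section lipschitz_gradient.
Context {R : realType} {n : nat}.
Context (f : 'cV[R]_n -> R) (L : R).
Context (f_partial : forall i x, derivable f x (delta_mx i 0)).
Context (f_lip :
  forall u v : 'cV[R]_n, enorm (grad f u - grad f v) <= L * enorm (u - v)).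

Let L_ge0 : (0 < n)%N -> 0 <= L.
Proof.
move=> n0; have := f_lip (delta_mx (Ordinal n0) 0) 0.
rewrite subr0 /enorm dotv_delta !mxE !eqxx sqrtr1 mulr1.
by apply: le_trans; exact: enorm_ge0.
Qed.

Lemma is_derive_line (x v : 'cV[R]_n) t : derivable f (x + t *: v) v ->
  is_derive t 1 (fun s => f (x + s *: v)) ('D_v f (x + t *: v)).
Proof.
have E : (fun h : R => h^-1 *: (((fun s => f (x + s *: v)) \o shift t) (h *: 1)
    - f (x + t *: v))) = (fun h => h^-1 *: ((f \o shift (x + t *: v)) (h *: v)
    - f (x + t *: v))).
  apply/funext => h /=; congr (_ *: (f _ - _)).
  by rewrite (_ : h%:A = h) ?scalerDl 1?addrCA //; exact: mulr1.
move=> hd; split; first by rewrite /derivable E.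
by rewrite /derive E.
Qed.

Lemma partial_lip i (u v : 'cV[R]_n) :
  `|partial i f u - partial i f v| <= L * enorm (u - v).
Proof.
apply: le_trans (f_lip u v).
by have := ler_entry_enorm (grad f u - grad f v) i; rewrite !mxE.
Qed.

Lemma coordinate_taylor (y : 'cV[R]_n) i t :
  `|f (y + t *: delta_mx i 0) - f y - t * partial i f y| <= L * t ^+ 2.
Proof.
have n0 : (0 < n)%N by apply: leq_ltn_trans (ltn_ord i).
have dg (s : R) : is_derive s 1 (fun s => f (y + s *: (t *: delta_mx i 0)))
    (t * partial i f (y + s *: (t *: delta_mx i 0))).
  pose g := fun r => f (y + r *: delta_mx i 0).
  have -> : (fun s => f (y + s *: (t *: delta_mx i 0))) = g \o (fun s => s * t).
    by apply/funext => r /=; rewrite /g scalerA.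
  rewrite mulrC; apply: is_derive1_comp.
    rewrite scalerA; apply: is_derive_line; exact: f_partial.
  have -> : (fun s0 : R => s0 * t) = (fun s0 => t *: s0).
    by apply/funext => r; rewrite mulrC.
  by apply: is_derive_eq; rewrite /GRing.scale /= mulr1.
have key (s : R) : 0 < s < 1 -> `|t * partial i f (y + s *: (t *: delta_mx i 0)) -
   t * partial i f (y + 0 *: (t *: delta_mx i 0))| <= L * t ^+ 2 * s.
  move=> /andP[s0 s1]; rewrite -mulrBr normrM.
  rewrite (@le_trans _ _
    (`|t| * (L * enorm (s *: (t *: delta_mx i 0 : 'cV[R]_n))))) //.
    rewrite ler_wpM2l ?normr_ge0 // (le_trans (partial_lip _ _ _)) //.
    by rewrite scale0r addr0 addrAC subrr add0r.
  rewrite !enormZ (ger0_norm (ltW s0)) /enorm dotv_delta !mxE !eqxx sqrtr1 mulr1.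
  by rewrite -(real_normK (num_real t)) le_eqVlt; apply/orP; left; apply/eqP; ring.
have L0 := L_ge0 n0.
have Lt : 0 <= L * t ^+ 2 by rewrite mulr_ge0 ?sqr_ge0.
have := taylor1_abs dg key; rewrite scale0r !scale1r addr0.
by move=> /le_trans; apply; lra.
Qed.

(** Differentiability of [f] is not assumed: only the partial derivatives are
    known to exist.  Moving from [x] to [x + h] one coordinate at a time
    replaces it, at the price of a constant that depends on [n]. *)
Lemma grad_taylor_crude (x h : 'cV[R]_n) :
  `|f (x + h) - f x - dotv (grad f x) h| <= n%:R * (2 * L * enorm h ^+ 2).
Proof.
pose tr k : 'cV[R]_n := \col_i (if (i < k)%N then h i 0 else 0).
pose S k := \sum_(i < n | (i < k)%N) partial i f x * h i 0.
have -> : dotv (grad f x) h = S n.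
  rewrite dotvE /S; apply: eq_big => [i|i _]; first by rewrite ltn_ord.
  by rewrite mxE.
have -> : h = tr n by apply/colP => i; rewrite mxE ltn_ord.
have -> : enorm (tr n) = enorm h.
  by congr enorm; apply/colP => i; rewrite mxE ltn_ord.
suff : forall k, (k <= n)%N ->
    `|f (x + tr k) - f x - S k| <= k%:R * (2 * L * enorm h ^+ 2) by exact.
elim=> [_|k IH kn].
  have -> : tr 0%N = 0 by apply/colP => i; rewrite !mxE.
  by rewrite addr0 subrr /S big_pred0 // subrr normr0 mul0r.
pose i := Ordinal kn.
have n0 : (0 < n)%N by exact: (leq_ltn_trans _ (ltn_ord i)).
have L0 := L_ge0 n0.
have trS : tr k.+1 = tr k + h i 0 *: delta_mx i 0.
  apply/colP => j; rewrite !mxE eqxx andbT ltnS leq_eqVlt -val_eqE /=.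
  have [e|ne] /= := eqVneq (j : nat) k; last by rewrite mulr0 addr0.
  by rewrite e ltnn add0r mulr1; congr (h _ _); apply: val_inj.
have SS : S k.+1 = S k + partial i f x * h i 0.
  rewrite /S (bigD1 i) //= addrC; congr (_ + _); apply: eq_bigl => j.
  by rewrite ltnS [in RHS]ltn_neqAle -val_eqE /= andbC.
have htr : enorm (tr k) <= enorm h.
  apply: le_of_sqr_le; first exact: enorm_ge0.
  rewrite !sqr_enorm !dotvE; apply: ler_sum => j _; rewrite !mxE.
  by case: ifP => // _; rewrite mulr0 -expr2 sqr_ge0.
have hi : `|h i 0| <= enorm h by exact: ler_entry_enorm.
have := IH (ltnW kn).
have := coordinate_taylor (x + tr k) i (h i 0).
rewrite -[x + tr k + _]addrA -trS SS.
have : `|h i 0 * (partial i f (x + tr k) - partial i f x)|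
    <= L * enorm h ^+ 2.
  rewrite normrM (@le_trans _ _ (`|h i 0| * (L * enorm (tr k)))) //.
    rewrite ler_wpM2l // (le_trans (partial_lip _ _ _)) //.
    by rewrite addrAC subrr add0r.
  by rewrite mulrCA ler_wpM2l // expr2 ler_pM // enorm_ge0.
have : L * h i 0 ^+ 2 <= L * enorm h ^+ 2.
  rewrite ler_wpM2l // -[h i 0 ^+ 2]real_normK ?num_real //.
  by rewrite ler_sqr ?nnegrE ?enorm_ge0.
rewrite -[in X in _ -> X]natr1 !ler_norml => ? /andP[? ?] /andP[? ?] /andP[? ?].
apply/andP; split; lra.
Qed.

Lemma is_derive_direction (x v : 'cV[R]_n) (t : R) :
  is_derive t 1 (fun s => f (x + s *: v)) (dotv (grad f (x + t *: v)) v).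
Proof.
apply: (@is_derive_quadratic _ _ _ _ (n%:R * (2 * L * enorm v ^+ 2))) => h.
have := grad_taylor_crude (x + t *: v) (h *: v).
rewrite -[x + _ + _]addrA -scalerDl dotvZr enormZ exprMn real_normK ?num_real //.
by move=> /le_trans; apply; rewrite le_eqVlt; apply/orP; left; apply/eqP; ring.
Qed.

(** The descent lemma.  The constant [L / 2] does not depend on [n] because,
    once [f] has a derivative along the whole segment, the Lipschitz bound is
    integrated along that segment. *)
Lemma grad_taylor (x v : 'cV[R]_n) :
  `|f (x + v) - f x - dotv (grad f x) v| <= L / 2 * enorm v ^+ 2.
Proof.
have dg := is_derive_direction x v.
have key (s : R) : 0 < s < 1 ->
    `|dotv (grad f (x + s *: v)) v - dotv (grad f (x + 0 *: v)) v|
      <= L * enorm v ^+ 2 * s.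
  move=> /andP[s0 _]; rewrite -dotvBl (le_trans (cauchy_schwarz _ _)) //.
  rewrite (@le_trans _ _ (L * enorm (s *: v) * enorm v)) //.
    rewrite ler_wpM2r ?enorm_ge0 // (le_trans (f_lip _ _)) //.
    by rewrite scale0r addr0 [x + _]addrC addrK.
  rewrite enormZ (ger0_norm (ltW s0)).
  by rewrite le_eqVlt; apply/orP; left; apply/eqP; ring.
have := taylor1_abs dg key; rewrite scale0r !scale1r addr0.
by move=> /le_trans; apply; lra.
Qed.

Lemma grad_convex_le (x y : 'cV[R]_n) : convex_function setT f ->
  f x + dotv (grad f x) (y - x) <= f y.
Proof.
move=> cf; set v := y - x; apply/ler_addgt0Pr => e e0.
pose a := L / 2 * enorm v ^+ 2.
pose t : R := Num.min 1 (e / (1 + `|a|)).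
have a1 : 0 < 1 + `|a| by rewrite ltr_pwDl.
have t0 : 0 < t by rewrite lt_min ltr01 divr_gt0.
have t1 : t <= 1 by rewrite ge_min lexx.
have ta : t * a <= e.
  rewrite (@le_trans _ _ (t * (1 + `|a|))) //.
    by rewrite ler_wpM2l ?(ltW t0) // (le_trans (ler_norm _)) // lerDr.
  by rewrite -ler_pdivlMr // ge_min lexx orbT.
have := grad_taylor x (t *: v).
rewrite dotvZr enormZ (ger0_norm (ltW t0)) ler_norml => /andP[+ _].
have := cf (Itv01 (ltW t0) t1) y x (mem_setT _) (mem_setT _).
rewrite convRE /=.
have -> : conv (Itv01 (ltW t0) t1) (y : convex_lmodType _)
    (x : convex_lmodType _) = x + t *: v.
  rewrite /conv /= /unstable.onem scalerBl scale1r scalerBr.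
  by rewrite addrCA.
rewrite /unstable.onem => h1 h2; rewrite -(ler_pM2l t0).
have : t * (t * a) <= t * e by rewrite ler_pM2l.
move: h1 h2; rewrite /a exprMn; lra.
Qed.

(** A gradient step of length [1 / L] would decrease [f] by
    [|grad f y| ^ 2 / (2 L)]. *)
Lemma grad_argmin (y : 'cV[R]_n) : 0 < L -> argmin f y -> grad f y = 0.
Proof.
move=> L0 ymin; apply: enorm_eq0; apply/eqP; rewrite -sqrf_eq0; apply/eqP.
apply/le_anti; rewrite sqr_ge0 andbT.
have := ymin (y + (- L^-1) *: grad f y).
have := grad_taylor y ((- L^-1) *: grad f y).
rewrite dotvZr enormZ normrN [`|L^-1|]gtr0_norm ?invr_gt0 //.
rewrite -sqr_enorm; set g := enorm (grad f y).
have -> : L / 2 * (L^-1 * g) ^+ 2 = L^-1 / 2 * g ^+ 2.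
  by field; rewrite gt_eqF.
rewrite ler_norml => /andP[_ h1] h2.
have : L^-1 / 2 * g ^+ 2 <= 0 by lra.
by rewrite pmulr_rle0 // divr_gt0 // invr_gt0.
Qed.

Lemma continuous_lipschitz_grad : continuous f.
Proof.
move=> x; apply/(@cvgrPdist_le _ _ _ (nbhs x) (nbhs_filter x)) => e e0.
have [n0|n0] := posnP n.
  apply: (@nearW _ (nbhs x)) => y; rewrite (_ : y = x) ?subrr ?normr0 ?ltW //.
  by apply/colP => -[j jn]; exfalso; move: jn; rewrite n0.
have L0 := L_ge0 n0.
pose c := Num.sqrt n%:R : R.
have c0 : 0 <= c := sqrtr_ge0 _.
pose B := enorm (grad f x) * c + L / 2 * c ^+ 2.
have B0 : 0 <= B by rewrite addr_ge0 ?mulr_ge0 ?enorm_ge0 ?sqr_ge0 ?invr_ge0.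
have B1 : 0 < B + 1 by lra.
have FF : Filter (nbhs x) := nbhs_filter x.
have r0 : 0 < Num.min 1 (e / (B + 1)) by rewrite lt_min ltr01 divr_gt0.
apply: filterS (nbhsx_ballx x _ r0) => y.
rewrite -ball_normE /= lt_min => /andP[/ltW y1 /ltW yB].
have ny : enorm (y - x) <= c * `|x - y|.
  apply: ler_enorm_unif => // j; rewrite distrC.
  exact: ler_entry_mx_norm.
have ny0 := enorm_ge0 (y - x).
have h1 := cauchy_schwarz (grad f x) (y - x).
have h2 := grad_taylor x (y - x).
rewrite [x + _]addrC subrK in h2.
have h3 : enorm (grad f x) * enorm (y - x) <= enorm (grad f x) * c * `|x - y|.
  by rewrite -mulrA ler_wpM2l ?enorm_ge0.
have h4 : L / 2 * enorm (y - x) ^+ 2 <= L / 2 * c ^+ 2 * `|x - y|.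
  rewrite -[L / 2 * c ^+ 2 * _]mulrA ler_wpM2l ?mulr_ge0 ?invr_ge0 //.
  rewrite (@le_trans _ _ ((c * `|x - y|) ^+ 2)) //.
    by rewrite ler_sqr ?nnegrE // mulr_ge0.
  by rewrite exprMn ler_wpM2l ?sqr_ge0 // expr2 ler_piMr.
have h5 : (B + 1) * `|x - y| <= e by rewrite mulrC -ler_pdivlMr.
have h6 : 0 <= `|x - y| by [].
have h7 : `|f y - f x| <= B * `|x - y|.
  move: h1 h2; rewrite /B !ler_norml => /andP[? ?] /andP[? ?].
  by apply/andP; split; lra.
by rewrite distrC; lra.
Qed.

(** The supremum over the sublevel set is finite only if each of its points
    has minimisers at distance at most [R0 + e]. *)
Lemma sublevel_near_argmin (x0 : 'cV[R]_n) R0 x e :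
  sublevel_radius f x0 = R0%:E -> f x <= f x0 -> 0 < e ->
  exists2 y, argmin f y & enorm (x - y) <= R0 + e.
Proof.
move=> hR fx e0; apply: contrapT => no.
have : (ereal_inf [set (enorm (x - y))%:E | y in argmin f] <= R0%:E)%E.
  by rewrite -hR; apply: ereal_sup_ubound; exists x.
suff : ((R0 + e)%:E <=
    ereal_inf [set (enorm (x - y))%:E | y in argmin f])%E.
  by move=> h1 h2; have := le_trans h1 h2; rewrite lee_fin; lra.
apply/ereal_infP => _ [y ymin <-]; rewrite lee_fin leNgt.
by apply/negP => /ltW h; apply: no; exists y.
Qed.

Lemma sublevel_radius_ge0 (x0 : 'cV[R]_n) R0 :
  sublevel_radius f x0 = R0%:E -> 0 <= R0.
Proof.
move=> hR; apply/ler_addgt0Pr => e e0.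
have [y _ h] := sublevel_near_argmin hR (lexx _) e0.
by rewrite (le_trans _ h) // enorm_ge0.
Qed.

Lemma optimal_value_argmin fstar y : optimal_value f = fstar%:E ->
  argmin f y -> f y = fstar.
Proof.
move=> hf ymin; apply: EFin_inj; rewrite -hf; apply/le_anti/andP; split.
  by apply/ereal_infP => _ [z _ <-]; rewrite lee_fin.
by apply: ereal_inf_lbound; exists y.
Qed.

Lemma optimal_value_le fstar x : optimal_value f = fstar%:E -> fstar <= f x.
Proof.
by move=> hf; rewrite -lee_fin -hf; apply: ereal_inf_lbound; exists x.
Qed.

Lemma gap_le_grad (x0 : 'cV[R]_n) R0 fstar x : convex_function setT f ->
  optimal_value f = fstar%:E -> sublevel_radius f x0 = R0%:E ->
  f x <= f x0 -> f x - fstar <= R0 * enorm (grad f x).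
Proof.
move=> cf hf hR fx; apply/ler_addgt0Pr => e e0.
have g0 := enorm_ge0 (grad f x).
have e1 : 0 < e / (1 + enorm (grad f x)) by rewrite divr_gt0 //; lra.
have [y ymin xy] := sublevel_near_argmin hR fx e1.
rewrite -(optimal_value_argmin hf ymin).
have h1 := grad_convex_le x y cf.
have h2 := cauchy_schwarz (grad f x) (y - x).
have h3 : enorm (grad f x) * enorm (y - x) <=
    enorm (grad f x) * (R0 + e / (1 + enorm (grad f x))).
  by rewrite ler_wpM2l // -enormN opprB.
have h4 : enorm (grad f x) * (e / (1 + enorm (grad f x))) <= e.
  by rewrite mulrCA ler_piMr ?(ltW e0) // ler_pdivrMr //; lra.
by move: h2; rewrite ler_norml => /andP[? _]; lra.
Qed.

Lemma gap_le_radius (x0 : 'cV[R]_n) R0 fstar x : 0 < L ->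
  optimal_value f = fstar%:E -> sublevel_radius f x0 = R0%:E ->
  f x <= f x0 -> f x - fstar <= L / 2 * R0 ^+ 2.
Proof.
move=> L0 hf hR fx; have R00 := sublevel_radius_ge0 hR.
apply/ler_addgt0Pr => e e0.
pose a := Num.min 1 (e / (L / 2 * (2 * R0 + 1))).
have c0 : 0 < L / 2 * (2 * R0 + 1) by rewrite mulr_gt0 ?divr_gt0 //; lra.
have a0 : 0 < a by rewrite lt_min ltr01 divr_gt0.
have a1 : a <= 1 by rewrite ge_min lexx.
have ae : L / 2 * (2 * R0 + 1) * a <= e.
  by rewrite mulrC -ler_pdivlMr // ge_min lexx orbT.
have [y ymin xy] := sublevel_near_argmin hR fx a0.
rewrite -(optimal_value_argmin hf ymin).
have := grad_taylor y (x - y).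
rewrite (grad_argmin L0 ymin) dotvC dotv0r subr0 [y + _]addrC subrK ler_norml.
move=> /andP[_ h]; rewrite (le_trans h) //.
rewrite (@le_trans _ _ (L / 2 * (R0 + a) ^+ 2)) //.
  by rewrite ler_wpM2l ?mulr_ge0 ?invr_ge0 ?(ltW L0) // ler_sqr ?nnegrE
    ?enorm_ge0 // addr_ge0 // ltW.
rewrite (@le_trans _ _ (L / 2 * R0 ^+ 2 + L / 2 * (2 * R0 + 1) * a)) //;
  last by rewrite lerD2l.
have : L / 2 * (a * a) <= L / 2 * a.
  by rewrite ler_wpM2l ?mulr_ge0 ?invr_ge0 ?(ltW L0) // ler_piMl // ltW.
by rewrite !expr2; lra.
Qed.

End lipschitz_gradient.

(** * One iteration *)

Section finite_differences.
Context {R : realType} {n : nat} {f : 'cV[R]_n -> R} {L : R}.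
Context (f_partial : forall i x, derivable f x (delta_mx i 0)).
Context (f_lip :
  forall u v : 'cV[R]_n, enorm (grad f u - grad f v) <= L * enorm (u - v)).
Implicit Types x : 'cV[R]_n.

Lemma fdgrad_entry_error r (A : 'M[R]_(n, r)) x e i : 0 < e ->
  `|(fdgrad f e A x - A^T *m grad f x) i 0|
    <= L / 2 * e * enorm (col i A) ^+ 2.
Proof.
move=> e0; rewrite !mxE -colE; set v := col i A.
have -> : \sum_j A^T i j * grad f x j 0 = dotv (grad f x) v.
  by rewrite dotvE; apply: eq_bigr => j _; rewrite !mxE mulrC.
have := grad_taylor f_partial f_lip x (e *: v).
have := grad_taylor f_partial f_lip x (- (e *: v)).
rewrite dotvNr dotvZr enormN enormZ (gtr0_norm e0) exprMn opprK.
set a := f (x - e *: v); set b := f (x + e *: v) => h1 h2.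
rewrite (_ : _ / _ - _ = ((b - f x - e * dotv (grad f x) v) -
  (a - f x + e * dotv (grad f x) v)) / (2 * e)); last by field; lra.
rewrite normrM [`|(2 * e)^-1|]gtr0_norm ?invr_gt0 ?mulr_gt0 //.
rewrite ler_pdivrMr ?mulr_gt0 // (le_trans (ler_normB _ _)) //.
rewrite (le_trans (lerD h2 h1)) // le_eqVlt; apply/orP; left; apply/eqP.
by field.
Qed.

Lemma fdgrad_error r (A : 'M[R]_(n, r)) x e s : 0 <= L -> 0 < e ->
  (forall i, enorm (col i A) ^+ 2 <= s) -> 0 <= s ->
  enorm (fdgrad f e A x - A^T *m grad f x) <= Num.sqrt r%:R * (L / 2 * e * s).
Proof.
move=> L0 e0 As s0; apply: ler_enorm_unif => [|i].
  by rewrite !mulr_ge0 // ltW.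
apply: le_trans (fdgrad_entry_error A x i e0) _.
by rewrite ler_wpM2l // !mulr_ge0 // ltW.
Qed.

(** If [h] is within [eta] of [v := Q^T grad f x] then
    [<grad f x, Q h> = <v, h> >= |h| (|v| - 2 eta)], while
    [|Q h| <= sqrt s |h|]. *)
Lemma sketch_direction d (Q : 'M[R]_(n, d)) x e s t : 0 <= L -> 0 < e ->
  0 < s -> opnorm (Q *m Q^T) <= s -> t <= enorm (Q^T *m grad f x) ->
  Num.sqrt d%:R * L * e * s < t ->
  (t - Num.sqrt d%:R * L * e * s) / Num.sqrt s
    <= dotv (grad f x) (normalize (Q *m fdgrad f e Q x)).
Proof.
move=> L0 e0 s0 Qs tv ltt; set h := fdgrad f e Q x; set v := Q^T *m grad f x.
pose eta := Num.sqrt d%:R * (L / 2 * e * s).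
have S0 : 0 < Num.sqrt s by rewrite sqrtr_gt0.
have hv : enorm (h - v) <= eta.
  apply: fdgrad_error => // [i|]; last exact: ltW.
  have := enorm_mulmx_gram (delta_mx i 0) (ltW s0) Qs.
  rewrite -colE /enorm dotv_delta mxE !eqxx sqrtr1 mulr1 -!/(enorm _) => hi.
  by rewrite -(sqr_sqrtr (ltW s0)) ler_sqr ?nnegrE ?enorm_ge0 ?(ltW S0).
have e2 : 2 * eta = Num.sqrt d%:R * L * e * s by rewrite /eta; field.
have eta0 : 0 <= eta by rewrite (le_trans (enorm_ge0 _) hv).
have h_lb : t - eta <= enorm h.
  by have := ler_enormB v (v - h); rewrite subKr -(opprB h v) enormN; lra.
have h0 : 0 < enorm h by lra.
have key : enorm h * (t - 2 * eta) <= dotv (grad f x) (Q *m h).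
  rewrite dotv_adj -/v; have := dotv_le (h - v) h.
  rewrite dotvBl -sqr_enorm expr2 => h1.
  have : enorm (h - v) * enorm h <= eta * enorm h by rewrite ler_wpM2r // ltW.
  have : enorm h * (t - eta) <= enorm h * enorm h by rewrite ler_wpM2l // ltW.
  by lra.
have Qh : enorm (Q *m h) <= Num.sqrt s * enorm h.
  exact: enorm_mulmx_gram (ltW s0) Qs.
have Qh0 : 0 < enorm (Q *m h).
  rewrite lt_def enorm_ge0 andbT; apply/eqP => /enorm_eq0 z.
  have : 0 < enorm h * (t - 2 * eta) by rewrite mulr_gt0 //; lra.
  by rewrite z dotv0r in key; lra.
rewrite dotvZr -e2 ler_pdivrMr // -[X in _ <= X]mulrA ler_pdivlMl //.
apply: (@le_trans _ _ (Num.sqrt s * enorm h * (t - 2 * eta))).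
  by rewrite ler_wpM2r //; lra.
by rewrite -mulrA mulrC ler_wpM2r // ltW.
Qed.

Context {m : nat}.
Implicit Types (H : 'M[R]_m) (A : 'M[R]_(n, m)) (g : 'cV[R]_m).

(** The sufficient decrease condition can only fail at a step length [b] for
    which the quadratic term of the descent lemma dominates; applied to the
    last rejected length [beta ^ i.-1], this bounds the accepted one from
    below.  The term [r], due to [g] not being the exact gradient, shortens
    the step by at most the fraction [r / gam], whatever [c] is, since
    [(1 - c) gam - r >= (1 - 2 c) (gam - r)] for [r <= gam / 2]. *)
Lemma line_search_step_lb (beta c M1 M2 : R) x A H g (i : nat) :
  (0 < m)%N -> 0 < L -> 0 < beta < 1 -> 0 < c < 1 / 2 -> 0 < M1 -> 0 < M2 ->
  spectral_bounds M1 M2 H -> (forall j, enorm (col j A) <= 1) ->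
  let gam := dotv g (H *m g) in
  let r := `|dotv (A^T *m grad f x - g) (H *m g)| in
  r <= gam / 2 -> 0 < gam ->
  (forall l, (l < i)%N -> ~ armijo f c x A g (- (H *m g)) (beta ^+ l)) ->
  Num.min 1 (2 * beta * (1 - 2 * c) / (m%:R * M2 * L)) * (gam - r)
    <= beta ^+ i * gam.
Proof.
move=> m0 L0 /andP[b0 b1] /andP[c0 c1] M10 M20 sH A1 gam r rg g0 rej.
have r0 : 0 <= r by exact: normr_ge0.
have mp : 0 < m%:R :> R by rewrite ltr0n.
have D0 : 0 < m%:R * M2 * L by rewrite !mulr_gt0.
case: i rej => [_|i rej].
  rewrite expr0 mul1r (@le_trans _ _ (1 * (gam - r))) //; last by lra.
  by rewrite ler_wpM2r ?ge_min ?lexx //; lra.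
have := rej i (ltnSn i); rewrite /armijo => /negP.
set b := beta ^+ i; have bp : 0 < b by rewrite exprn_gt0.
rewrite -ltNge mulmxN scalerN dotvNr -/gam => fail.
have := grad_taylor f_partial f_lip x (- (b *: (A *m (H *m g)))).
rewrite ler_norml => /andP[_].
rewrite dotvNr dotvZr enormN enormZ (gtr0_norm bp) exprMn dotv_adj => tay.
have nA : enorm (A *m (H *m g)) ^+ 2 <= m%:R * (M2 * gam).
  apply: (@le_trans _ _ ((Num.sqrt m%:R * enorm (H *m g)) ^+ 2)).
    rewrite ler_sqr ?nnegrE ?mulr_ge0 ?sqrtr_ge0 ?enorm_ge0 //.
    by have := enorm_mulmx_le (H *m g) ler01 A1; rewrite mulr1.
  rewrite exprMn sqr_sqrtr ?ler0n // ler_wpM2l ?ler0n //.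
  exact: spectral_bounds_sqr (ltW M10) sH.
have rr : gam - r <= dotv (A^T *m grad f x) (H *m g).
  have : - r <= dotv (A^T *m grad f x - g) (H *m g).
    by rewrite lerNl ler_normr lexx orbT.
  by rewrite dotvBl -/gam; lra.
have q1 : L / 2 * (b ^+ 2 * enorm (A *m (H *m g)) ^+ 2) <=
    b * (b * (m%:R * M2 * L) / 2 * gam).
  have -> : b * (b * (m%:R * M2 * L) / 2 * gam) =
      L / 2 * (b ^+ 2 * (m%:R * (M2 * gam))) by field.
  by rewrite !ler_wpM2l ?sqr_ge0 // ?divr_ge0 // ltW.
have q2 : b * (gam - r) <= b * dotv (A^T *m grad f x) (H *m g).
  by rewrite ler_wpM2l // ltW.
have q3 : b * ((1 - c) * gam - r) <= b * (b * (m%:R * M2 * L) / 2 * gam).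
  by lra.
rewrite ler_pM2l // in q3.
have q4 : (1 - 2 * c) * (gam - r) <= b * (m%:R * M2 * L) / 2 * gam.
  apply: le_trans q3; have : 0 <= c * (gam - 2 * r) by rewrite mulr_ge0; lra.
  by lra.
apply: (@le_trans _ _ (2 * beta * (1 - 2 * c) / (m%:R * M2 * L) * (gam - r))).
  by rewrite ler_wpM2r ?ge_min ?lexx ?orbT //; lra.
rewrite mulrAC ler_pdivrMr // exprS -/b.
have := ler_wpM2l (ltW b0) q4; lra.
Qed.

(** With [gam = <g, H g>] and [|err| <= w], Cauchy--Schwarz and
    [|H g| ^ 2 <= M2 gam] give [r <= w sqrt (M2 gam)], small against [gam] as
    soon as [|g|] exceeds [2 sqrt (M2 / M1) w].  Then
    [gam - r >= sqrt gam (sqrt gam - sqrt M1 mu)]. *)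
Lemma curvature_lb (M1 M2 : R) H g (err : 'cV[R]_m) w :
  0 < M1 -> 0 < M2 -> spectral_bounds M1 M2 H -> enorm err <= w ->
  let mu := Num.sqrt (M2 / M1) * w in
  2 * mu <= enorm g -> 0 < enorm g ->
  let gam := dotv g (H *m g) in let r := `|dotv err (H *m g)| in
  [/\ 0 < gam, r <= gam / 2 & M1 * (enorm g - mu) ^+ 2 <= gam - r].
Proof.
move=> M10 M20 sH ew mu gmu g0 gam r.
have w0 : 0 <= w by exact: le_trans (enorm_ge0 _) ew.
have mu0 : 0 <= mu by rewrite mulr_ge0 ?sqrtr_ge0.
have gam_lb : M1 * enorm g ^+ 2 <= gam.
  by rewrite sqr_enorm; exact: spectral_bounds_ge sH.
have gam0 : 0 < gam by apply: lt_le_trans gam_lb; rewrite mulr_gt0 ?exprn_gt0.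
pose G := Num.sqrt gam; pose N := Num.sqrt M1.
have N0 : 0 < N by rewrite sqrtr_gt0.
have NN : N ^+ 2 = M1 by rewrite sqr_sqrtr // ltW.
have GG : G ^+ 2 = gam by rewrite sqr_sqrtr // ltW.
have G0 : 0 <= G by exact: sqrtr_ge0.
have G_lb : N * enorm g <= G.
  apply: le_of_sqr_le => //; rewrite exprMn NN GG //.
have r_ub : r <= G * (N * mu).
  apply: le_trans (cauchy_schwarz _ _) _.
  apply: (@le_trans _ _ (w * (Num.sqrt M2 * G))).
    apply: ler_pM; rewrite ?enorm_ge0 //.
    apply: le_of_sqr_le; first by rewrite mulr_ge0 ?sqrtr_ge0.
    rewrite exprMn GG (sqr_sqrtr (ltW M20)).
    exact: spectral_bounds_sqr (ltW M10) sH.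
  rewrite /mu sqrtrM ?(ltW M20) // sqrtrV ?(ltW M10) // -/N.
  by rewrite le_eqVlt; apply/orP; left; apply/eqP; field; rewrite gt_eqF.
have Nmu : 2 * (N * mu) <= G.
  by apply: le_trans G_lb; rewrite mulrCA ler_pM2l.
split=> //; first by rewrite -GG; nra.
rewrite -GG -NN; apply: (@le_trans _ _ (G * (G - N * mu))); last by lra.
have h1 : 0 <= enorm g - mu by lra.
have h2 : N * (enorm g - mu) <= G - N * mu by lra.
have h3 : N * (enorm g - mu) <= G by have := mulr_ge0 (ltW N0) mu0; lra.
rewrite -exprMn expr2; by apply: ler_pM => //; rewrite mulr_ge0 // ltW.
Qed.


Lemma fd_step_le (beta c M1 M2 e : R) A (W : 'M[R]_m) x H x' H' :
  0 < beta -> 0 < c -> 0 <= M1 -> spectral_bounds M1 M2 H ->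
  fd_step f beta c M1 M2 e A W x H x' H' -> f x' <= f x.
Proof.
move=> b0 c0 M10 sH [i [+ _ -> _]]; rewrite /armijo => /le_trans; apply.
rewrite gerDl dotvNr mulrN oppr_le0 !mulr_ge0 ?exprn_ge0 ?(ltW c0) ?(ltW b0) //.
apply: le_trans (spectral_bounds_ge _ sH).
by rewrite mulr_ge0 ?dotvv_ge0.
Qed.

(** The two terms of [K] dominate, after multiplication by
    [u := sqrt ((1 - eps) d / s)], the finite-difference errors along the
    sketched direction and along the columns of the window.  For the second
    error the geometric mean of the two terms is used: there the factors
    [1 - eps] cancel, and [1 / 96 <= s] is what remains to be assumed of [s]
    for [m >= 2] and [c < 1 / 2]. *)
Lemma precision_constant_lb (d : nat) (eps s c M1 M2 K : R) :
  (0 < d)%N -> (1 < m)%N -> 0 < L -> 0 < eps < 1 -> 0 < c < 1 / 2 ->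
  0 < M1 -> 0 < M2 -> 1 / 96 <= s ->
  4 * Num.sqrt d%:R * s / (1 - eps) * L <= K ->
  6 * s * m%:R ^+ 2 / d%:R * (M2 / (M1 * c) + 1) * L <= K ->
  let a := Num.sqrt ((1 - eps) * d%:R) in let S := Num.sqrt s in
  a <= S ->
  (Num.sqrt d%:R * S + 1 / 2) * L <= a / S * K /\
  Num.sqrt (M2 / M1) * Num.sqrt m%:R * L <= a / S * K.
Proof.
move=> d0 m1 L0 /andP[e0 e1] /andP[c0 c1] M10 M20 s96 K1 K2 a S aS.
have s0 : 0 < s by lra.
have dp : 1 <= d%:R :> R by rewrite ler1n.
have mp : 2 <= m%:R :> R by rewrite ler_nat.
have a0 : 0 < a by rewrite sqrtr_gt0 mulr_gt0 //; lra.
have S0 : 0 < S by rewrite sqrtr_gt0.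
have aa : a ^+ 2 = (1 - eps) * d%:R by rewrite sqr_sqrtr // mulr_ge0 //; lra.
have SS : S ^+ 2 = s by rewrite sqr_sqrtr // ltW.
pose D := Num.sqrt d%:R : R.
have DD : D ^+ 2 = d%:R by rewrite sqr_sqrtr // ler0n.
have D1 : 1 <= D by rewrite -sqrtr1 ler_sqrt // ltr0n.
have aD : a <= D.
  apply: le_of_sqr_le; first by lra.
  by rewrite aa DD ler_piMl //; lra.
have u0 : 0 < a / S by rewrite divr_gt0.
(* [K] is at least its first term, in which [1 - eps = a ^ 2 / d]. *)
have K1' : 4 * D * D ^+ 2 * S / a * L <= a / S * K.
  apply: le_trans (ler_wpM2l (ltW u0) K1); rewrite le_eqVlt; apply/orP; left.
  have -> : 1 - eps = a ^+ 2 / D ^+ 2 by rewrite aa DD mulfK //; lra.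
  by rewrite -SS -/D; apply/eqP; field; rewrite ?gt_eqF //; lra.
split.
  apply: le_trans K1'; rewrite ler_pM2r // ler_pdivlMr //.
  rewrite -/D; have h1 : a * S <= D * S by rewrite ler_pM2r.
  have h2 : 1 <= D ^+ 2 by rewrite -(expr1n _ 2) ler_sqr ?nnegrE //; lra.
  have h3 : D * S <= D * D ^+ 2 * S.
    by rewrite ler_pM2r // ler_peMr //; lra.
  have h4 : D * S * a <= D * S * D by rewrite ler_wpM2l // mulr_ge0 //; lra.
  have h5 : D * S * D <= D * D ^+ 2 * S.
    rewrite -mulrA mulrC [S * D]mulrC -mulrA.
    have D0 := le_trans ler01 D1.
    by have := ler_peMr (mulr_ge0 D0 (mulr_ge0 D0 (ltW S0))) D1; lra.
  have h6 : a <= D * D ^+ 2 * S.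
    apply: le_trans aS (le_trans _ h3); apply: ler_peMl => //; exact: ltW.
  by lra.
pose M := M2 / M1; have M0 : 0 < M by exact: divr_gt0.
have M2c : 2 * M <= M2 / (M1 * c).
  have -> : M2 / (M1 * c) = M / c by rewrite /M invfM mulrA.
  rewrite ler_pdivlMr // mulrAC ler_piMl ?(ltW M0) //; lra.
pose X := 4 * D * s / (1 - eps) * L.
pose Y := 6 * s * m%:R ^+ 2 / d%:R * (M2 / (M1 * c) + 1) * L.
have X0 : 0 < X by rewrite !mulr_gt0 ?invr_gt0 //; lra.
have K0 : 0 < K by exact: lt_le_trans K1.
have Y0 : 0 < Y.
  by rewrite /Y !mulr_gt0 ?invr_gt0 ?exprn_gt0 //; lra.
have XY : X * Y <= K ^+ 2 by rewrite expr2; apply: ler_pM => //; exact: ltW.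
(* [X] and [Y] are the two terms of [K]; [1 - eps] cancels in their product. *)
have E : (a / S) ^+ 2 * (X * Y) =
    24 * (D * s) * (m%:R ^+ 2 * (M2 / (M1 * c) + 1)) * L ^+ 2.
  rewrite expr_div_n aa SS /X /Y; field.
  by rewrite !gt_eqF ?mulr_gt0 //=; lra.
apply: le_of_sqr_le; first by rewrite mulr_ge0 ?(ltW u0) ?(ltW K0).
rewrite 2![in X in X <= _]exprMn (sqr_sqrtr (ler0n _ m)) (sqr_sqrtr (ltW M0)).
apply: le_trans (_ : (a / S) ^+ 2 * (X * Y) <= _); last first.
  by rewrite [X in _ <= X]exprMn ler_wpM2l // sqr_ge0.
rewrite E ler_wpM2r ?sqr_ge0 //.
have p1 : 24 * (1 / 96) <= 24 * (D * s).
  by rewrite ler_pM2l // (le_trans s96) // ler_peMl // ltW.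
have p2 : m%:R * 2 * (2 * M) <= m%:R ^+ 2 * (M2 / (M1 * c) + 1).
  apply: ler_pM; [by rewrite mulr_ge0 // ler0n|by rewrite mulr_ge0 // ltW| |lra].
  by rewrite expr2 ler_wpM2l // ler0n.
have p3 : 0 <= m%:R * 2 * (2 * M) by apply: mulr_ge0; nra.
have p4 : 0 <= 24 * (1 / 96) :> R by lra.
have := ler_pM p4 p3 p1 p2; lra.
Qed.

(** The entry of [g] along the sketched column alone is at least
    [u |grad f x|] minus the finite-difference errors, with
    [u := sqrt ((1 - eps) d / s)]; [precision_constant_lb] absorbs these errors
    and the quantity [mu] of [curvature_lb] into [2 u K e], which leaves
    [enorm g - mu >= u (|grad f x| - 2 K e)].  On the event considered
    [u <= 1], so that [u ^ 2 >= u ^ 4]. *)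
Lemma fd_step_decrease (d : nat) (Q : 'M[R]_(n, d)) A (W : 'M[R]_m) x H x' H'
    (beta c M1 M2 e eps s K : R) :
  (0 < d)%N -> (1 < m)%N -> 0 < L -> 0 < beta < 1 -> 0 < c < 1 / 2 ->
  0 < M1 -> 0 < M2 -> 0 < e -> 0 < eps < 1 -> 1 / 96 <= s ->
  4 * Num.sqrt d%:R * s / (1 - eps) * L <= K ->
  6 * s * m%:R ^+ 2 / d%:R * (M2 / (M1 * c) + 1) * L <= K ->
  spectral_bounds M1 M2 H -> (forall j, enorm (col j A) <= 1) ->
  (exists j, col j A = normalize (Q *m fdgrad f e Q x)) ->
  fd_step f beta c M1 M2 e A W x H x' H' ->
  opnorm (Q *m Q^T) <= s ->
  (1 - eps) * d%:R * enorm (grad f x) ^+ 2 <= enorm (Q^T *m grad f x) ^+ 2 ->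
  2 * K * e < enorm (grad f x) ->
  f x' <= f x - c * Num.min 1 (2 * beta * (1 - 2 * c) / (m%:R * M2 * L)) * M1
    * ((1 - eps) * d%:R / s) ^+ 2 * (enorm (grad f x) - 2 * K * e) ^+ 2.
Proof.
move=> d0 m1 L0 hb hc M10 M20 e0 he s96 K1 K2 sH A1 [j Aj] step Qs Qx xK.
have [c0 c1] := andP hc; have [eps0 eps1] := andP he.
have s0 : 0 < s by lra.
have dp : 1 <= d%:R :> R by rewrite ler1n.
set a : R := Num.sqrt ((1 - eps) * d%:R); set S : R := Num.sqrt s.
set del := enorm (grad f x).
have S0 : 0 < S by rewrite sqrtr_gt0.
have SS : S ^+ 2 = s by rewrite sqr_sqrtr // ltW.
have a0 : 0 < a by rewrite sqrtr_gt0 mulr_gt0 //; lra.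
have aa : a ^+ 2 = (1 - eps) * d%:R by rewrite sqr_sqrtr // mulr_ge0 //; lra.
have K0 : 0 < K.
  by apply: lt_le_trans K1; rewrite !mulr_gt0 ?invr_gt0 ?sqrtr_gt0 //; lra.
have del0 : 0 < del by apply: lt_trans xK; rewrite !mulr_gt0.
have tv : a * del <= enorm (Q^T *m grad f x).
  by apply: le_of_sqr_le; rewrite ?enorm_ge0 // exprMn aa.
have aS : a <= S.
  rewrite -(ler_pM2r del0) (le_trans tv) //; apply: le_of_sqr_le.
    by rewrite mulr_ge0 // ltW.
  by rewrite exprMn SS; exact: enorm_tr_mulmx_gram.
have [KS Kmu] := precision_constant_lb d0 m1 L0 he hc M10 M20 s96 K1 K2 aS.
have u0 : 0 < a / S by rewrite divr_gt0.
rewrite -/S in KS Kmu.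
set u : R := a / S in KS Kmu u0 *.
have uq : u ^+ 2 = (1 - eps) * d%:R / s by rewrite expr_div_n aa SS.
have u1 : u <= 1 by rewrite ler_pdivrMr // mul1r.
set D := Num.sqrt d%:R : R in KS *.
have D0 : 0 <= D by exact: sqrtr_ge0.
have small : D * L * e * s < a * del.
  have h1 : D * L * e * s <= S * (u * K) * e.
    rewrite -SS; have := ler_wpM2r (ltW e0) (ler_wpM2l (ltW S0) KS).
    have : 0 <= S * (1 / 2 * L) * e by rewrite !mulr_ge0 // ?ltW //; lra.
    lra.
  have h2 : S * (u * K) * e = a * (K * e) by rewrite /u; field; rewrite gt_eqF.
  have h3 : a * (2 * K * e) < a * del by rewrite ltr_pM2l.
  have h4 : 0 < a * (K * e) by rewrite !mulr_gt0.
  by lra.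
have dirn := sketch_direction (ltW L0) e0 s0 Qs tv small.
set g := fdgrad f e A x in step *.
have gA : enorm (g - A^T *m grad f x) <= Num.sqrt m%:R * (L / 2 * e * 1).
  apply: fdgrad_error => // [|i]; first exact: ltW.
  by rewrite expr_le1 ?A1 ?enorm_ge0.
have g_lb : u * del - D * L * e * S - L / 2 * e <= enorm g.
  apply: le_trans (ler_entry_enorm g j); apply: le_trans (ler_norm _).
  have := fdgrad_entry_error A x j e0; rewrite -/g Aj.
  have -> : (g - A^T *m grad f x) j 0 =
      g j 0 - dotv (grad f x) (normalize (Q *m fdgrad f e Q x)).
    rewrite -Aj !mxE dotvE; congr (_ - _); apply: eq_bigr => k _.
    by rewrite !mxE mulrC.
  have p1 := enorm_normalize_le1 (Q *m fdgrad f e Q x).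
  have : L / 2 * e * enorm (normalize (Q *m fdgrad f e Q x)) ^+ 2
      <= L / 2 * e.
    by rewrite ler_piMr ?expr_le1 ?enorm_ge0 // mulr_ge0 ?divr_ge0 // ltW.
  have E : (a * del - D * L * e * s) / S = u * del - D * L * e * S.
    by rewrite /u -SS; field; rewrite gt_eqF.
  rewrite E in dirn; rewrite ler_norml => h1 /andP[h2 _]; lra.
pose w := Num.sqrt m%:R * (L / 2 * e * 1).
pose mu := Num.sqrt (M2 / M1) * w.
have mu0 : 0 <= mu by rewrite !mulr_ge0 ?sqrtr_ge0 ?invr_ge0 // ltW.
have Kmu' : 2 * mu <= u * K * e.
  have := ler_wpM2r (ltW e0) Kmu; rewrite /mu /w; lra.
have KS' : (D * L * e * S + L / 2 * e) <= u * K * e.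
  have := ler_wpM2r (ltW e0) KS; lra.
have xK' : 0 < u * (del - 2 * K * e) by rewrite mulr_gt0 // subr_gt0.
have gmu : 2 * mu <= enorm g by lra.
have g0 : 0 < enorm g.
  have : 0 < u * K * e by apply: mulr_gt0 => //; exact: mulr_gt0.
  by lra.
have gA' : enorm (A^T *m grad f x - g) <= w by rewrite -enormN opprB.
have [gam0 rgam gam_lb] := curvature_lb M10 M20 sH gA' gmu g0.
case: step => i [acc rej -> _].
have := line_search_step_lb (ltnW m1) L0 hb hc M10 M20 sH A1 rgam gam0 rej.
set ab := Num.min 1 _ => ls.
have ab0 : 0 <= ab.
  rewrite le_min ler01 divr_ge0 //.
    by rewrite !mulr_ge0 //; have [? ?] := andP hb; lra.
  by rewrite !mulr_ge0 // ltW.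
apply: le_trans acc _; rewrite -uq lerD2l dotvNr mulrN lerN2.
have Xmu : u * (del - 2 * K * e) <= enorm g - mu by lra.
move: (del - 2 * K * e) Xmu xK' => X Xmu X0; rewrite -/mu in gam_lb.
clearbody u.
have h1 : u ^+ 2 ^+ 2 * X ^+ 2 <= (enorm g - mu) ^+ 2.
  apply: (@le_trans _ _ (u ^+ 2 * X ^+ 2)).
    by rewrite ler_wpM2r ?sqr_ge0 // expr2 ler_piMr ?sqr_ge0 // expr_le1 // ltW.
  by rewrite -exprMn ler_sqr ?nnegrE ?(ltW X0) // (le_trans (ltW X0)).
have h2 := le_trans (ler_wpM2l (ltW M10) h1) gam_lb.
have h3 := ler_wpM2l (ltW c0) (le_trans (ler_wpM2l ab0 h2) ls).
by rewrite [X in _ <= X]mulrA in h3; apply: le_trans h3; rewrite !mulrA.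
Qed.

Lemma eigen_clip_spectral (M1 M2 : R) (A B : 'M[R]_m) : M1 <= M2 ->
  eigen_clip M1 M2 A B -> spectral_bounds M1 M2 B.
Proof.
move=> M12 [U [v [UU _ ->]]]; set v' := map_mx _ v.
have UU' : U *m U^T = 1%:M by apply: mulmx1C.
have bnd i : M1 <= v' 0 i <= M2.
  by rewrite mxE le_min M12 !le_max lexx ge_min lexx.
have psd_conj (w : 'rV[R]_m) : (forall i, 0 <= w 0 i) ->
    psd (U *m diag_mx w *m U^T).
  move=> w0; split; first by rewrite !trmx_mul trmxK tr_diag_mx mulmxA.
  move=> z; rewrite -!mulmxA dotv_adj dotvE sumr_ge0 // => i _.
  rewrite mul_diag_mx !mxE mulrCA -expr2 mulr_ge0 ?sqr_ge0 //.
have scal a : a%:M = U *m diag_mx (const_mx a) *m U^T.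
  by rewrite diag_const_mx mul_mx_scalar -scalemxAl UU' scalemx1.
split; first by rewrite !trmx_mul trmxK tr_diag_mx mulmxA.
- rewrite scal -mulmxBl -mulmxBr -linearB; apply: psd_conj => i.
  by rewrite !mxE subr_ge0; have := bnd i; rewrite mxE => /andP[].
- rewrite scal -mulmxBl -mulmxBr -linearB; apply: psd_conj => i.
  by rewrite !mxE subr_ge0; have := bnd i; rewrite mxE => /andP[].
Qed.

Lemma fd_step_spectral (beta c M1 M2 e : R) A (W : 'M[R]_m) x H x' H' :
  M1 <= M2 -> spectral_bounds M1 M2 W ->
  fd_step f beta c M1 M2 e A W x H x' H' -> spectral_bounds M1 M2 H'.
Proof.
move=> M12 sW [i [_ _ _]]; case: ifP => _; first by move->.
exact: eigen_clip_spectral.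
Qed.

End finite_differences.

(** * Measurability of the iterates *)

Section measurable_matrices.
Context {R : realType} {disp : measure_display} {T : measurableType disp}.

Definition measurable_mx {p q} (X : T -> 'M[R]_(p, q)) : Prop :=
  forall i j, measurable_fun setT (fun w => X w i j).

(** An open set of matrices is a union of boxes with rational centres and
    radii [k.+1^-1], hence a countable one. *)
Lemma measurable_mx_open p q (X : T -> 'M[R]_(p, q)) (V : set 'M[R]_(p, q)) :
  measurable_mx X -> open V -> measurable (X @^-1` V).
Proof.
move=> mX oV.
pose box (ck : 'M[rat]_(p, q) * nat) : set 'M[R]_(p, q) :=
  [set M | forall i j, `|M i j - ratr (ck.1 i j)| < ck.2.+1%:R^-1].
pose F ck : set T := if `[< box ck `<=` V >] then X @^-1` box ck else set0.
have -> : X @^-1` V = \bigcup_ck F ck.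
  apply/seteqP; split=> [w /= Vw|w [ck _]]; last first.
    by rewrite /F; case: ifPn => // /asboolP bV; exact: bV.
  have /nbhs_ballP[e /= e0 eV] := open_nbhs_nbhs (conj oV Vw).
  have [k ke] : exists k : nat, k.+1%:R^-1 < e / 2.
    have e2 : 0 < (e / 2)^-1 by rewrite invr_gt0 divr_gt0.
    exists (Num.truncn (e / 2)^-1).
    by rewrite -[X in _ < X]invrK ltf_pV2 ?posrE // truncnS_gt.
  have kp : 0 < k.+1%:R^-1 :> R by rewrite invr_gt0.
  (* The radius is abstracted from its expression in [k], which linear
     arithmetic does not handle. *)
  pose box' (r : R) (c : 'M[rat]_(p, q)) : set 'M[R]_(p, q) :=
    [set M | forall i j, `|M i j - ratr (c i j)| < r].
  have boxE c : box (c, k) = box' k.+1%:R^-1 c by [].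
  move: ke kp boxE; move: (k.+1%:R^-1) => rr ke kp boxE.
  have rat_near i j : exists r : rat, `|X w i j - ratr r| < rr.
    have [|r] := @rat_in_itvoo R (X w i j - rr) (X w i j + rr).
      by lra.
    by rewrite in_itv /= => /andP[? ?]; exists r; rewrite ltr_norml; lra.
  pose c : 'M[rat]_(p, q) := \matrix_(i, j) xchoose (rat_near i j).
  exists (c, k) => //; rewrite /F.
  have cw : box (c, k) (X w).
    by rewrite boxE => i j /=; rewrite mxE; exact: (xchooseP (rat_near i j)).
  case: ifPn => // /asboolP; case => M; rewrite boxE in cw *; move=> /= bM; apply: eV.
  split=> // i j; rewrite /ball /=.
  have := bM i j; have := cw i j; rewrite /= !ltr_norml.
  by move=> /andP[? ?] /andP[? ?]; apply/andP; split; lra.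
apply: countable_bigcupT_measurable => [|ck]; first exact: countableP.
rewrite /F; case: ifPn => // _.
have -> : X @^-1` box ck = \bigcap_(ij in [set: 'I_p * 'I_q])
    ((fun w => X w ij.1 ij.2) @^-1`
      [set t | `|t - ratr (ck.1 ij.1 ij.2)| < ck.2.+1%:R^-1]).
  apply/seteqP; split=> [w /= h [i j] _|w /= h i j]; first exact: h.
  exact: (h (i, j)).
apply: fin_bigcap_measurable => //.
move=> [i j] _ /=; rewrite -[X in measurable X]setTI; apply: mX => //.
have -> : [set t : R | `|t - ratr (ck.1 i j)| < ck.2.+1%:R^-1] =
    ball (ratr (ck.1 i j) : R) ck.2.+1%:R^-1.
  by apply/seteqP; split=> t; rewrite /ball /= distrC.
exact: measurable_ball.
Qed.

Lemma measurable_fun_of_open p q (X : T -> 'M[R]_(p, q)) (D : set T)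
    (b : T -> R) : measurable_mx X -> measurable D ->
  (forall t, exists2 V, open V & forall w, D w -> V (X w) <-> b w < t) ->
  measurable_fun D b.
Proof.
move=> mX mD h; apply: (measurability _ (RGenInftyO.measurableE R)).
move=> _ [_ [t ->] <-]; have [V oV hV] := h t.
have -> : D `&` b @^-1` `]-oo, t[ = D `&` X @^-1` V.
  by apply/seteqP; split=> w [Dw] /=; rewrite in_itv /= => /(hV w Dw).
by apply: measurableI => //; exact: measurable_mx_open.
Qed.

Lemma measurable_mx_continuous p q (X : T -> 'M[R]_(p, q))
    (F : 'M[R]_(p, q) -> R) :
  measurable_mx X -> continuous F -> measurable_fun setT (fun w => F (X w)).
Proof.
move=> mX cF; apply: (measurable_fun_of_open mX) => // t.
exists (F @^-1` `]-oo, t[%classic).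
  by apply: open_comp => //; move=> x _; exact: cF.
by move=> w _; rewrite /= in_itv.
Qed.

(** A function [b] that varies no faster than [X] factors through an open
    condition on [X]: the set where [b < t] is the preimage under [X] of the
    balls centred at [X w] of radius [(t - b w) / K], for all [w] with
    [b w < t].  No formula for [b] in terms of [X] is needed. *)
Lemma measurable_fun_lipschitz p q (X : T -> 'M[R]_(p, q)) (D : set T)
    (b : T -> R) K : measurable_mx X -> measurable D -> 0 < K ->
  (forall w w', D w -> D w' -> b w' - b w <= K * `|X w - X w'|) ->
  measurable_fun D b.
Proof.
move=> mX mD K0 h; apply: (measurable_fun_of_open mX) => // t.
exists (\bigcup_(w in [set w | D w /\ b w < t])
    ball (X w) ((t - b w) / K)).
  apply: bigcup_open => w [Dw bw]; exact: ball_open.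
move=> w Dw; split=> [[w' [Dw' bw']]|bw]; last first.
  by exists w => //; apply: ballxx; rewrite divr_gt0 // subr_gt0.
rewrite -ball_normE /= ltr_pdivlMr // mulrC => XX.
have := h w' w Dw' Dw; lra.
Qed.

Lemma measurable_mxD p q (X Y : T -> 'M[R]_(p, q)) :
  measurable_mx X -> measurable_mx Y -> measurable_mx (fun w => X w + Y w).
Proof.
move=> mX mY i j.
under eq_fun do rewrite mxE.
by apply: measurable_funD.
Qed.

Lemma measurable_mxZ p q (a : T -> R) (X : T -> 'M[R]_(p, q)) :
  measurable_fun setT a -> measurable_mx X ->
  measurable_mx (fun w => a w *: X w).
Proof.
move=> ma mX i j.
under eq_fun do rewrite mxE.
by apply: measurable_funM.
Qed.

Lemma measurable_mxN p q (X : T -> 'M[R]_(p, q)) :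
  measurable_mx X -> measurable_mx (fun w => - X w).
Proof.
move=> mX i j.
under eq_fun do rewrite mxE.
by apply: measurable_funN; exact: mX.
Qed.

Lemma measurable_mxB p q (X Y : T -> 'M[R]_(p, q)) :
  measurable_mx X -> measurable_mx Y -> measurable_mx (fun w => X w - Y w).
Proof. by move=> mX mY; apply: measurable_mxD => //; exact: measurable_mxN. Qed.

Lemma measurable_mxM p q r (X : T -> 'M[R]_(p, q)) (Y : T -> 'M[R]_(q, r)) :
  measurable_mx X -> measurable_mx Y -> measurable_mx (fun w => X w *m Y w).
Proof.
move=> mX mY i j.
under eq_fun do rewrite mxE.
by apply: measurable_sum => k; apply: measurable_funM.
Qed.

Lemma measurable_mxT p q (X : T -> 'M[R]_(p, q)) :
  measurable_mx X -> measurable_mx (fun w => (X w)^T).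
Proof. by move=> mX i j; under eq_fun do rewrite mxE; exact: mX. Qed.

Lemma measurable_dotv p (X Y : T -> 'cV[R]_p) :
  measurable_mx X -> measurable_mx Y ->
  measurable_fun setT (fun w => dotv (X w) (Y w)).
Proof.
by move=> mX mY; apply: measurable_mxM => //; exact: measurable_mxT.
Qed.

Lemma measurable_fun_inv (a : T -> R) :
  measurable_fun setT a -> measurable_fun setT (fun w => (a w)^-1).
Proof.
move=> ma.
(* Real powers are measurable, and this formula also holds at [t = 0]. *)
have E t : t^-1 = t * (`|t| `^ (-1)) ^+ 2 :> R.
  rewrite powR_inv1 // exprVn real_normK ?num_real //.
  by have [->|t0] := eqVneq t 0; [rewrite invr0 mul0r|field].
under eq_fun do rewrite E.
apply: measurable_funM => //; apply: measurable_funX.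
apply: (measurableT_comp (measurable_powR (-1))).
by apply: (measurableT_comp (@normr_measurable _ setT)).
Qed.

Lemma measurable_enorm p (X : T -> 'cV[R]_p) :
  measurable_mx X -> measurable_fun setT (fun w => enorm (X w)).
Proof.
move=> mX; have ms : measurable_fun setT (@Num.sqrt R).
  by apply: continuous_measurable_fun; exact: sqrt_continuous.
exact: measurableT_comp ms (measurable_dotv mX mX).
Qed.

Lemma measurable_normalize p (X : T -> 'cV[R]_p) :
  measurable_mx X -> measurable_mx (fun w => normalize (X w)).
Proof.
move=> mX; apply: measurable_mxZ => //.
by apply: measurable_fun_inv; exact: measurable_enorm.
Qed.

Lemma measurable_pred (D : T -> bool) :
  measurable_fun setT D -> measurable [set w | D w].
Proof.
by move=> mD; rewrite -[X in measurable X]setTI; apply: (mD _ [set true]).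
Qed.

End measurable_matrices.

Section measurable_run.
Context {R : realType} {disp : measure_display} {T : measurableType disp}.
Context {n d m : nat} {f : 'cV[R]_n -> R}.
Context (f_cont : continuous f).

Lemma measurable_fdgrad r (e : R) (A : T -> 'M[R]_(n, r)) (x : T -> 'cV[R]_n) :
  measurable_mx A -> measurable_mx x ->
  measurable_mx (fun w => fdgrad f e (A w) (x w)).
Proof.
move=> mA mx i j; under eq_fun do rewrite mxE.
have mv : measurable_mx (fun w => e *: (A w *m delta_mx i (0 : 'I_1))).
  by apply: measurable_mxZ => //; apply: measurable_mxM.
apply: measurable_funM => //; apply: measurable_funB.
  by apply: measurable_mx_continuous => //; exact: measurable_mxD.
by apply: measurable_mx_continuous => //; exact: measurable_mxB.
Qed.

Lemma measurable_push_cols (A : T -> 'M[R]_(n, m)) (u v : T -> 'cV[R]_n) :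
  measurable_mx A -> measurable_mx u -> measurable_mx v ->
  measurable_mx (fun w => push_cols (A w) (u w) (v w)).
Proof.
move=> mA mu mv i j; under eq_fun do rewrite mxE.
case: insub => [j2|]; first exact: mA.
by case: (j.+2 == m); [exact: mu|exact: mv].
Qed.

Lemma measurable_armijo c a (x : T -> 'cV[R]_n) (A : T -> 'M[R]_(n, m))
    (g dir : T -> 'cV[R]_m) :
  measurable_mx x -> measurable_mx A -> measurable_mx g -> measurable_mx dir ->
  measurable [set w | armijo f c (x w) (A w) (g w) (dir w) a].
Proof.
move=> mx mA mg mdir; apply: measurable_pred; apply: measurable_fun_ler.
  apply: measurable_mx_continuous => //; apply: measurable_mxD => //.
  by apply: measurable_mxZ => //; exact: measurable_mxM.
apply: measurable_funD; first exact: measurable_mx_continuous.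
by apply: measurable_funM => //; exact: measurable_dotv.
Qed.

Lemma measurable_bfgs_update (H : T -> 'M[R]_m) (s y : T -> 'cV[R]_m) :
  measurable_mx H -> measurable_mx s -> measurable_mx y ->
  measurable_mx (fun w => bfgs_update (H w) (s w) (y w)).
Proof.
move=> mH ms my; have md := measurable_fun_inv (measurable_dotv ms my).
have mI : measurable_mx (fun _ : T => 1%:M : 'M[R]_m).
  by move=> ? ?; exact: measurable_cst.
rewrite /bfgs_update; apply: measurable_mxD.
  apply: measurable_mxM; first apply: measurable_mxM => //.
    apply: measurable_mxB => //; apply: measurable_mxZ => //.
    by apply: measurable_mxM => //; exact: measurable_mxT.
  apply: measurable_mxB => //; apply: measurable_mxZ => //.
  by apply: measurable_mxM => //; exact: measurable_mxT.
apply: measurable_mxZ => //.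
by apply: measurable_mxM => //; exact: measurable_mxT.
Qed.

(** Clipping the eigenvalues is the projection onto the convex set of
    symmetric matrices with spectrum in [[M1, M2]], for the Frobenius inner
    product [tr (X Y)]; this is its variational inequality. *)
Lemma eigen_clip_variational (M1 M2 : R) (A B B' : 'M[R]_m) : M1 <= M2 ->
  eigen_clip M1 M2 A B -> spectral_bounds M1 M2 B' ->
  \tr ((A - B) *m (B' - B)) <= 0.
Proof.
move=> M12 [U [v [UU -> ->]]] sB'; set v' := map_mx _ v.
have UU' : U *m U^T = 1%:M by apply: mulmx1C.
rewrite -mulmxBl -mulmxBr -linearB /=.
have -> : B' - U *m diag_mx v' *m U^T =
    U *m (U^T *m B' *m U - diag_mx v') *m U^T.
  by rewrite mulmxBr mulmxBl !mulmxA UU' mul1mx -[B' *m _ *m _]mulmxA UU' mulmx1.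
set N := U^T *m B' *m U - diag_mx v'.
rewrite (_ : _ *m _ = U *m (diag_mx (v - v') *m N *m U^T)); last first.
  by rewrite !mulmxA -[_ *m U^T *m U]mulmxA UU mulmx1.
rewrite mxtrace_mulC -!mulmxA UU mulmx1 /mxtrace sumr_le0 // => i _.
rewrite mul_diag_mx !mxE eqxx mulr1n.
have -> : \sum_j (U^T *m B') i j * U j i = dotv (col i U) (B' *m col i U).
  rewrite dotv_adj dotvE; apply: eq_bigr => j _.
  by rewrite !mxE; congr (_ * _); apply: eq_bigr => k _; rewrite !mxE mulrC.
have u1 : dotv (col i U) (col i U) = 1.
  have <- : (U^T *m U) i i = 1 by rewrite UU mxE eqxx.
  by rewrite mxE dotvE; apply: eq_bigr => j _; rewrite !mxE.
have := spectral_bounds_ge (col i U) sB'; have := spectral_bounds_le (col i U) sB'.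
rewrite u1 !mulr1; move: (dotv _ _) => t t2 t1.
have [h|] := boolP (v 0 i <= M1).
  rewrite (max_idPl h) (min_idPr M12).
  by rewrite mulr_le0_ge0 ?subr_le0 ?subr_ge0.
rewrite -ltNge => h; have [h2|] := boolP (v 0 i <= M2).
  by rewrite (max_idPr (ltW h)) (min_idPr h2) subrr mul0r.
rewrite -ltNge => h2.
rewrite (max_idPr (ltW h)) (min_idPl (ltW h2)).
by rewrite mulr_ge0_le0 ?subr_le0 ?subr_ge0 // ltW.
Qed.

Lemma mxtrace_sqr (A : 'M[R]_m) : A^T = A ->
  \tr (A *m A) = \sum_i \sum_j A i j ^+ 2.
Proof.
move=> As; apply: eq_bigr => i _; rewrite mxE; apply: eq_bigr => j _.
by rewrite expr2 -{2}As mxE.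
Qed.

(** Adding the variational inequalities of the two projections gives
    [tr ((B - B') ^ 2) <= tr ((A - A') (B - B'))].  The Lipschitz bound makes
    the clipped matrix a measurable function of the matrix to be clipped,
    although [eigen_clip] only provides some diagonalisation of it. *)
Lemma eigen_clip_lipschitz (M1 M2 : R) (A B A' B' : 'M[R]_m) i j : M1 <= M2 ->
  eigen_clip M1 M2 A B -> eigen_clip M1 M2 A' B' ->
  `|B' i j - B i j| <= m%:R * `|A - A'|.
Proof.
move=> M12 AB AB'.
have sB := eigen_clip_spectral M12 AB; have sB' := eigen_clip_spectral M12 AB'.
have h1 := eigen_clip_variational M12 AB sB'.
have h2 := eigen_clip_variational M12 AB' sB.
have tX : (A' - A)^T = A' - A.
  case: AB AB' => [U [v [_ -> _]]] [U' [v' [_ -> _]]].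
  by rewrite raddfB /= !trmx_mul !trmxK !tr_diag_mx !mulmxA.
have tY : (B' - B)^T = B' - B.
  by case: sB sB' => [Bs _ _] [B's _ _]; rewrite raddfB /= Bs B's.
have {h1 h2} h3 : \tr ((B' - B) *m (B' - B)) <= \tr ((A' - A) *m (B' - B)).
  move: h1 h2; rewrite !mulmxBl !mulmxBr !raddfB /=; lra.
have -> : B' i j - B i j = (B' - B) i j by rewrite !mxE.
rewrite distrC; move: (A' - A) (B' - B) tX tY h3 => X Y tX tY h3.
have h4 : 0 <= \tr ((X - Y) *m (X - Y)).
  rewrite mxtrace_sqr; last by rewrite raddfB /= tX tY.
  by rewrite sumr_ge0 // => k _; rewrite sumr_ge0 // => l _; rewrite sqr_ge0.
have h5 := mxtrace_mulC X Y.
have {h3 h4 h5} h6 : \tr (Y *m Y) <= \tr (X *m X).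
  by move: h4; rewrite !mulmxBl !mulmxBr !raddfB /=; lra.
apply: le_of_sqr_le; first by rewrite mulr_ge0.
rewrite real_normK ?num_real //.
have h7 : Y i j ^+ 2 <= \tr (Y *m Y).
  rewrite mxtrace_sqr // (bigD1 i) //= (bigD1 j) //= -addrA lerDl addr_ge0 //.
    by rewrite sumr_ge0 // => l _; rewrite sqr_ge0.
  by rewrite sumr_ge0 // => k _; rewrite sumr_ge0 // => l _; rewrite sqr_ge0.
apply: le_trans h7 (le_trans h6 _); rewrite mxtrace_sqr //.
apply: (@le_trans _ _ (\sum_(i < m) \sum_(j < m) `|X| ^+ 2)).
  apply: ler_sum => k _; apply: ler_sum => l _.
  rewrite -[X in X <= _]real_normK ?num_real //.
  by rewrite ler_sqr ?nnegrE // ler_entry_mx_norm.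
by rewrite !sumr_const !card_ord exprMn -mulrnA -natrX mulr_natl mulnn.
Qed.

(** The accepted exponent [i] is a measurable function of [w], because the
    events that the [l]-th trial is accepted are measurable; the new state is
    then treated on each of the countably many events where [i] is fixed. *)
Lemma measurable_fd_step (beta c M1 M2 e : R) (A : T -> 'M[R]_(n, m))
    (W : T -> 'M[R]_m) (x : T -> 'cV[R]_n) (H : T -> 'M[R]_m)
    (x' : T -> 'cV[R]_n) (H' : T -> 'M[R]_m) : M1 <= M2 ->
  measurable_mx A -> measurable_mx W -> measurable_mx x -> measurable_mx H ->
  (forall w, fd_step f beta c M1 M2 e (A w) (W w) (x w) (H w) (x' w) (H' w)) ->
  measurable_mx x' /\ measurable_mx H'.
Proof.
move=> M12 mA mW mx mH step.
pose g w := fdgrad f e (A w) (x w); pose dir w := - (H w *m g w).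
have mg : measurable_mx g by exact: measurable_fdgrad.
have mdir : measurable_mx dir by apply: measurable_mxN; exact: measurable_mxM.
pose acc l := [set w | armijo f c (x w) (A w) (g w) (dir w) (beta ^+ l)].
have macc l : measurable (acc l) by exact: measurable_armijo.
pose E l := acc l `\` \bigcup_(k in [set k | (k < l)%N]) acc k.
have mE l : measurable (E l).
  by apply: measurableD => //; apply: bigcup_measurable.
have cover : setT = \bigcup_l E l.
  apply/esym/seteqP; split=> // w _; have [l [al rl _ _]] := step w.
  by exists l => //; split=> // -[k /= kl ak]; exact: rl ak.
have on_E l w : E l w -> x' w = x w + beta ^+ l *: (A w *m dir w) /\
    (if dotv (beta ^+ l *: dir w) (fdgrad f e (A w) (x' w) - g w) == 0
     then H' w = W w else eigen_clip M1 M2 (bfgs_update (H w)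
       (beta ^+ l *: dir w) (fdgrad f e (A w) (x' w) - g w)) (H' w)).
  move=> [al rl]; have [k [ak rk hx hH]] := step w.
  have lk : l = k.
    case: (ltngtP l k) => [lk|kl|//]; first by case: (rk _ lk al).
    by case: rl; exists k.
  by rewrite lk.
have mx' : measurable_mx x'.
  move=> i j; rewrite cover; apply/measurable_fun_bigcup => // l.
  apply: (eq_measurable_fun (fun w => (x w + beta ^+ l *: (A w *m dir w)) i j)).
    by move=> w; rewrite inE => /on_E[->].
  apply: measurable_funTS; apply: measurable_mxD => //.
  by apply: measurable_mxZ => //; exact: measurable_mxM.
split=> // i j; rewrite cover; apply/measurable_fun_bigcup => // l.
pose s w := beta ^+ l *: dir w; pose y w := fdgrad f e (A w) (x' w) - g w.
have ms : measurable_mx s by exact: measurable_mxZ.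
have my : measurable_mx y by apply: measurable_mxB => //; exact: measurable_fdgrad.
pose Z := [set w | dotv (s w) (y w) == 0].
have mZ : measurable Z.
  by apply: measurable_pred; apply: measurable_fun_eqr => //; exact: measurable_dotv.
have -> : E l = (E l `&` Z) `|` (E l `\` Z) by rewrite setUIDK.
apply/measurable_funU; [exact: measurableI|exact: measurableD|split].
  apply: (eq_measurable_fun (fun w => W w i j)).
    by move=> w; rewrite inE => -[/on_E[_ +] Zw]; rewrite ifT // => ->.
  by apply: measurable_funTS; exact: mW.
apply: (@measurable_fun_lipschitz _ _ _ _ _
  (fun w => bfgs_update (H w) (s w) (y w)) _ _ (m%:R + 1)).
- exact: measurable_bfgs_update.
- exact: measurableD.
- by rewrite ltr_wpDl.
move=> w w' [/on_E[_ h] Zw] [/on_E[_ h'] Zw'].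
rewrite ifF in h; last by apply/negP.
rewrite ifF in h'; last by apply/negP.
apply: le_trans (ler_norm _) (le_trans (eigen_clip_lipschitz i j M12 h h') _).
by rewrite ler_wpM2r // lerDl.
Qed.

End measurable_run.

(** * Independence of the current sketch from the past *)

Section independence.
Context {R : realType} {disp : measure_display} {T : measurableType disp}.
Context {P : probability T R}.

(** Both sides are finite measures in [A], so agreement on a generating
    pi-system suffices. *)
Lemma indep_generated (G : set (set T)) (C : set T) :
  G `<=` measurable -> setI_closed G -> G setT -> measurable C ->
  (forall A, G A -> P (A `&` C) = (P A * P C)%E) ->
  forall A, <<s G >> A -> P (A `&` C) = (P A * P C)%E.
Proof.
move=> Gm GI GT mC h A sGA.
have PCfin : P C \is a fin_num by exact: fin_num_measure.
have c0 : 0 <= fine (P C) by exact: fine_ge0.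
pose m1 : {measure set T -> \bar R} := mrestr P mC.
pose m2 : {measure set T -> \bar R} := mscale (NngNum c0) P.
have E B : measurable B -> m2 B = (P B * P C)%E.
  by move=> mB; rewrite /m2 /= /mscale /= fineK // muleC.
have mA : measurable A by exact: (smallest_sub (@sigma_algebra_measurable _ T) Gm).
rewrite -[LHS]/(m1 A) -E //.
apply: (@g_sigma_algebra_measure_unique _ _ _ G Gm (fun=> setT)) => //.
- by rewrite bigcup_const.
- by move=> B GB; rewrite E; [exact: h|exact: Gm].
- by move=> n; rewrite /m1 /= /mrestr setTI -ge0_fin_numE ?fin_num_measure.
Qed.

Context {I : eqType} (X : I -> T -> R).
Context (mX : forall i, measurable_fun setT (X i)).
Context (Xind : mutually_independent P X).

Definition generators (J : set I) : set (set T) :=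
  \bigcup_(i in J) preimage_set_system setT (X i) measurable.

(** The pi-system generated by the [X i], [i] in [J]. *)
Definition cylinders (J : set I) : set (set T) :=
  [set A | exists s B, [/\ uniq s, forall i, i \in s -> J i,
    forall i, measurable (B i) &
    A = \bigcap_(i in [set` s]) X i @^-1` B i]].

Lemma generators_measurable J : <<s generators J >> `<=` measurable.
Proof.
apply: smallest_sub; first exact: sigma_algebra_measurable.
by move=> _ [i _ [B mB <-]]; exact: mX.
Qed.

Lemma cylinders_measurable J : cylinders J `<=` measurable.
Proof.
move=> _ [s [B [_ _ mB ->]]]; apply: fin_bigcap_measurable => // i _.
by rewrite -[X in measurable X]setTI; exact: mX.
Qed.

Lemma generators_sub_cylinders J : <<s generators J >> `<=` <<s cylinders J >>.
Proof.
apply: sub_sigma_algebra2 => _ [i Ji [B mB <-]].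
exists [:: i], (fun=> B); split=> //.
  by move=> j; rewrite inE => /eqP ->.
rewrite setTI; apply/seteqP; split=> w /=.
  by move=> Bw j; rewrite /= inE => /eqP ->.
by apply; rewrite /= inE.
Qed.

Lemma cylinders_setI J : setI_closed (cylinders J).
Proof.
move=> _ _ [s [B [us sJ mB ->]]] [t [C [ut tJ mC ->]]].
exists (undup (s ++ t)), (fun i => (if i \in s then B i else setT) `&`
  (if i \in t then C i else setT)); split.
- exact: undup_uniq.
- by move=> i; rewrite mem_undup mem_cat => /orP[/sJ|/tJ].
- by move=> i; apply: measurableI; case: ifP.
apply/seteqP; split=> w /=.
  move=> [h1 h2] i _ /=; split; case: ifPn => // ii; [exact: h1|exact: h2].
move=> h; split=> i /= ii.
  have := h i; rewrite /= mem_undup mem_cat ii /= => /(_ isT)[].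
  by [].
have := h i; rewrite /= mem_undup mem_cat ii orbT => /(_ isT)[] _.
by [].
Qed.

Lemma cylinders_setT J : cylinders J setT.
Proof.
exists [::], (fun=> setT); split=> //.
by apply/seteqP; split=> // w _ i.
Qed.

Lemma indep_cylinders J1 J2 A B : (forall i, J1 i -> ~ J2 i) ->
  cylinders J1 A -> cylinders J2 B -> P (A `&` B) = (P A * P B)%E.
Proof.
move=> J12 [s [C [us sJ mC ->]]] [t [D [ut tJ mD ->]]].
have st i : i \in t -> i \notin s.
  by move=> it; apply/negP => is_; exact: (J12 i (sJ _ is_) (tJ _ it)).
pose E i := if i \in s then C i else D i.
have -> : \bigcap_(i in [set` s]) X i @^-1` C i `&`
    \bigcap_(i in [set` t]) X i @^-1` D i =
    \bigcap_(i in [set` s ++ t]) X i @^-1` E i.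
  apply/seteqP; split=> w /=.
    move=> [h1 h2] i /=; rewrite mem_cat /E; case: ifPn => /= [is_ _|_ it].
      exact: h1.
    exact: h2.
  move=> h; split=> i /= ii.
    by have := h i; rewrite /= mem_cat ii /E ii => /(_ isT).
  have := h i; rewrite /= mem_cat ii orbT /E (negbTE (st _ ii)).
  by move=> /(_ isT).
rewrite !Xind //.
- rewrite big_cat /=; congr (_ * _)%E; apply: eq_big_seq => i ii.
    by rewrite /E ii.
  by rewrite /E (negbTE (st _ ii)).
- rewrite cat_uniq us ut andbT /=; apply/hasPn => i it; exact: st.
- by move=> i; rewrite /E; case: ifP.
Qed.

Lemma indep_generators J1 J2 A B : (forall i, J1 i -> ~ J2 i) ->
  <<s generators J1 >> A -> <<s generators J2 >> B ->
  P (A `&` B) = (P A * P B)%E.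
Proof.
move=> J12 hA hB; have mB := generators_measurable hB.
apply: (indep_generated (@cylinders_measurable J1) (@cylinders_setI J1)
  (cylinders_setT J1) mB); last exact: generators_sub_cylinders.
move=> C cC; rewrite setIC muleC.
apply: (indep_generated (@cylinders_measurable J2) (@cylinders_setI J2)
  (cylinders_setT J2)); last exact: generators_sub_cylinders.
  exact: cylinders_measurable cC.
move=> D cD; rewrite setIC muleC; exact: (indep_cylinders J12).
Qed.

End independence.

Section product_law.
Context {R : realType} {disp : measure_display} {T : measurableType disp}.
Context {P : probability T R} (G1 G2 : set (set T)).
Let T1 := g_sigma_algebraType G1.
Let T2 := g_sigma_algebraType G2.
Context (mG1 : <<s G1 >> `<=` @measurable _ T).
Context (mG2 : <<s G2 >> `<=` @measurable _ T).
Context (ind : forall A B, <<s G1 >> A -> <<s G2 >> B ->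
  P (A `&` B) = (P A * P B)%E).

Let in1 : T -> T1 := id.
Let in2 : T -> T2 := id.
Let diag : T -> T1 * T2 := fun w => (w, w).

Let m_in1 : measurable_fun setT in1.
Proof. by move=> _ A mA; rewrite setTI; exact: mG1. Qed.

Let m_in2 : measurable_fun setT in2.
Proof. by move=> _ A mA; rewrite setTI; exact: mG2. Qed.

Let m_diag : measurable_fun setT diag.
Proof. by apply: measurable_fun_pair. Qed.

HB.instance Definition _ := isMeasurableFun.Build _ _ _ _ in1 m_in1.
HB.instance Definition _ := isMeasurableFun.Build _ _ _ _ in2 m_in2.
HB.instance Definition _ := isMeasurableFun.Build _ _ _ _ diag m_diag.

(** Under independence the law of [w |-> (w, w)] is the product of the two
    restrictions of [P]; Tonelli then integrates out the second copy first,
    with the first one frozen. *)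
Lemma indep_integral_ge (Y : T1 -> \bar R) (S : set (T1 * T2)) (p : R) :
  measurable_fun setT Y -> (forall w, 0 <= Y w)%E -> measurable S ->
  0 <= p -> (forall w, p%:E <= P [set w' | S (w, w')])%E ->
  (p%:E * \int[P]_w Y w <= \int[P]_w (Y w * (\1_S (w, w))%:E))%E.
Proof.
move=> mY Y0 mS p0 hp.
pose m1 := distribution P in1.
pose m2 := distribution P in2.
pose m' := distribution P diag.
have prodE A : measurable A -> (m1 \x m2)%E A = m' A.
  apply: product_measure_unique => B C mB mC.
  by rewrite /m' /m1 /m2 /distribution /pushforward /=; exact: ind.
pose F := fun z : T1 * T2 => (Y z.1 * (\1_S z)%:E)%E.
have F0 z : (0 <= F z)%E by rewrite mule_ge0 // lee_fin.
have mF : measurable_fun setT F.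
  apply: emeasurable_funM; first exact: (measurableT_comp mY).
  by apply/measurable_EFinP; exact: measurable_indic.
have -> : (\int[P]_w (Y w * (\1_S (w, w))%:E) = \int[m1 \x m2]_z F z)%E.
  rewrite (eq_measure_integral m'); last by move=> A mA _; exact: prodE.
  by rewrite /m' /distribution ge0_integral_pushforward.
rewrite fubini_tonelli1 //.
have -> : (\int[P]_w Y w = \int[m1]_w Y w)%E.
  by rewrite /m1 /distribution ge0_integral_pushforward.
rewrite -ge0_integralZl //.
apply: ge0_le_integral => //.
- by move=> w _; rewrite mule_ge0.
- exact: measurable_funeM.
- exact: measurable_fun_fubini_tonelli_F.
move=> w _; rewrite /fubini_F /F /=.
have mSw : measurable (xsection S w) by exact: measurable_xsection.
have m1S : measurable_fun setT (fun y => (\1_S (w, y))%:E : \bar R).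
  apply/measurable_EFinP; apply: measurableT_comp; last exact: measurable_pair1.
  exact: measurable_indic.
rewrite ge0_integralZl // muleC lee_wpmul2l //.
have -> : (fun y => (\1_S (w, y))%:E : \bar R) = (fun y => (\1_(xsection S w) y)%:E).
  by apply/funext => y; rewrite !indicE mem_xsection.
rewrite integral_indic // setIT.
apply: le_trans (hp w) _; rewrite /m2 /distribution /pushforward /=.
by rewrite /xsection /= le_eqVlt; apply/orP; left; apply/eqP; congr (P _);
  apply/seteqP; split=> y /=; rewrite inE.
Qed.

End product_law.

(** * The run as a process adapted to the sketches *)

Section window.
Context {R : realType} {n d m : nat} {f : 'cV[R]_n -> R}.
Context (e : nat -> R) (Pinit : 'M[R]_(n, m)) (Q : nat -> 'M[R]_(n, d)).
Context (x : nat -> 'cV[R]_n).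

(** The window before the two columns of step [k] are appended.  It only
    involves the sketches of the earlier steps, whereas [proj_mx] at step [k]
    already involves the current one. *)
Definition window k : 'M[R]_(n, m) :=
  if k is k'.+1 then proj_mx f e Pinit Q x k' else Pinit.

Lemma proj_mxE k : proj_mx f e Pinit Q x k = push_cols (window k)
  (normalize (x k)) (normalize (Q k *m fdgrad f (e k) (Q k) (x k))).
Proof. by case: k. Qed.

Lemma proj_mx_col_le1 k j : (forall j, enorm (col j Pinit) <= 1) ->
  enorm (col j (proj_mx f e Pinit Q x k)) <= 1.
Proof.
move=> P1; elim: k j => [|k IH] j; rewrite proj_mxE.
all: have -> A u v : col j (push_cols A u v) =
    if insub j.+2 : option 'I_m is Some j2 then col j2 A
    else if j.+2 == m then u else v.
1,3: by apply/colP => i; rewrite !mxE; case: insub => [j2|];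
  [rewrite mxE|case: ifP].
all: case: insub => [j2|] //; case: ifP => _; exact: enorm_normalize_le1.
Qed.

Lemma proj_mx_last k : (0 < m)%N -> exists j,
  col j (proj_mx f e Pinit Q x k) =
  normalize (Q k *m fdgrad f (e k) (Q k) (x k)).
Proof.
move=> m0; have jm : (m.-1 < m)%N by rewrite prednK.
exists (Ordinal jm); apply/colP => i; rewrite proj_mxE !mxE /= prednK //.
rewrite insubN ?ltnNge ?leqnSn //.
by rewrite gtn_eqF.
Qed.

End window.

Section opnorm_measurable.
Context {R : realType} {disp : measure_display} {T : measurableType disp}.

Lemma opnorm_lipschitz p q (A B : 'M[R]_(p, q)) :
  opnorm B - opnorm A <= Num.sqrt q%:R * Num.sqrt p%:R * `|A - B|.
Proof.
have c0 : 0 <= Num.sqrt p%:R * `|A - B| by rewrite mulr_ge0 ?sqrtr_ge0.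
rewrite lerBlDl; apply: opnorm_le => [v|]; last first.
  by rewrite addr_ge0 ?opnorm_ge0 // -mulrA mulr_ge0 ?sqrtr_ge0.
have -> : B *m v = A *m v + (B - A) *m v by rewrite mulmxBl addrC subrK.
rewrite mulrDl.
apply: le_trans (ler_enormD _ _) _; rewrite lerD ?enorm_opnorm_le //.
rewrite -[_ * _ * `|_|]mulrA; apply: enorm_mulmx_le => // j.
apply: ler_enorm_unif => // i; rewrite mxE.
by rewrite distrC ler_entry_mx_norm.
Qed.

Lemma measurable_opnorm p q (X : T -> 'M[R]_(p, q)) : measurable_mx X ->
  measurable_fun setT (fun w => opnorm (X w)).
Proof.
move=> mX.
apply: (measurable_fun_lipschitz mX _ (K := Num.sqrt q%:R * Num.sqrt p%:R + 1)).
- by [].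
- by rewrite ltr_wpDl // mulr_ge0 ?sqrtr_ge0.
move=> w w' _ _; apply: le_trans (opnorm_lipschitz _ _) _.
by rewrite ler_wpM2r // lerDl.
Qed.

End opnorm_measurable.

Section gaussian.
Context {R : realType} {disp : measure_display} {T : measurableType disp}.
Context {P : probability T R}.

Lemma standard_normal_small_ball (X : T -> R) (r : R) : 0 <= r ->
  standard_normal P X -> (P (X @^-1` `[(- r)%R, r]) <= r%:E)%E.
Proof.
move=> r0 [mX ->]; last exact: measurable_itv.
have peak : normal_peak 1 <= 1 / 2 :> R.
  rewrite /normal_peak expr1n mul1r div1r lef_pV2 ?posrE //; last first.
    by rewrite sqrtr_gt0 pmulrn_rgt0 // pi_gt0.
  have -> : 2 = Num.sqrt (2 ^+ 2) :> R by rewrite sqrtr_sqr ger0_norm.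
  rewrite ler_sqrt; last by rewrite -mulr_natr mulr_ge0 // pi_ge0.
  by have := pi_ge2 R; rewrite -mulr_natr expr2; lra.
rewrite /normal_prob; apply: (@le_trans _ _
  (\int[lebesgue_measure]_(x in `[(- r)%R, r]) (1 / 2 : R)%:E)%E).
  apply: ge0_le_integral => //.
  - by move=> x _; rewrite lee_fin normal_pdf_ge0.
  - apply/measurable_EFinP; apply: measurable_funTS.
    exact: measurable_normal_pdf.
  - move=> x _; rewrite lee_fin; apply: le_trans peak.
    by apply: normal_pdf_ub; exact: oner_neq0.
rewrite integral_cst //= lebesgue_measure_itv /= lte_fin.
case: ifPn => _; last by rewrite mule0 lee_fin.
by rewrite -EFinD -EFinM lee_fin; lra.
Qed.

Lemma gaussian_small_gram n d (Q : T -> 'M[R]_(n, d)) s (i : 'I_n) (j : 'I_d) :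
  0 <= s -> gaussian_mx P Q ->
  (P [set w | (opnorm (Q w *m (Q w)^T) <= s)%R] <= (Num.sqrt s)%:E)%E.
Proof.
move=> s0 [gQ _].
have mQ : measurable_mx Q by move=> k l; have [] := gQ (k, l).
apply: le_trans (standard_normal_small_ball (sqrtr_ge0 s) (gQ (i, j))).
have [mX _] := gQ (i, j).
apply: le_measure; rewrite ?inE.
- apply: measurable_pred; apply: measurable_fun_ler => //.
  by apply: measurable_opnorm; apply: measurable_mxM => //; exact: measurable_mxT.
- by rewrite -[X in measurable X]setTI; apply: mX.
move=> w /= ws; rewrite in_itv /=.
have := enorm_mulmx_gram (delta_mx j 0) s0 ws.
rewrite -colE [X in _ * X]/enorm dotv_delta mxE !eqxx sqrtr1 mulr1 => h.
have := le_trans (ler_entry_enorm (col j (Q w)) i) h.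
by rewrite mxE ler_norml.
Qed.

(** The Gaussian density is at most [1 / 2], so an interval of probability at
    least [1 - 2 / exp 1 >= 1 / 9] has half-length at least [1 / 9]; one entry
    of [Q] thus already keeps the bound [s] on the Gram matrix away from 0. *)
Lemma gram_constant_lb n d (Q : T -> 'M[R]_(n, d)) s (i : 'I_n) (j : 'I_d) :
  0 <= s -> gaussian_mx P Q ->
  ((1 - 2 * expR (- d%:R))%:E <=
    P [set w | (opnorm (Q w *m (Q w)^T) <= s)%R])%E ->
  1 / 96 <= s.
Proof.
move=> s0 gQ h; have := le_trans h (gaussian_small_gram i j s0 gQ).
rewrite lee_fin => {}h.
have d1 : 1 <= d%:R :> R by rewrite ler1n (leq_ltn_trans _ (ltn_ord j)).
have e1 : 9 / 4 <= expR 1 :> R.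
  have -> : expR 1 = expR (1 / 2) * expR (1 / 2) :> R.
    by rewrite -expRD; congr expR; lra.
  have := expR_ge1Dx (1 / 2 : R) => he.
  by have := ler_pM (ltac:(lra) : 0 <= 1 + 1 / 2 :> R)
     (ltac:(lra) : 0 <= 1 + 1 / 2 :> R) he he; lra.
have ed : expR (- d%:R) <= 4 / 9 :> R.
  apply: (@le_trans _ _ (expR (- 1))); first by rewrite ler_expR lerN2.
  rewrite expRN; apply: (@le_trans _ _ (9 / 4)^-1); last by lra.
  by rewrite lef_pV2 // posrE ?expR_gt0 //; lra.
have r9 : 1 / 9 <= Num.sqrt s by lra.
rewrite -(sqr_sqrtr s0) expr2.
by have := ler_pM (ltac:(lra) : 0 <= 1 / 9 :> R)
     (ltac:(lra) : 0 <= 1 / 9 :> R) r9 r9; lra.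
Qed.

Lemma probability_setI_ge (A B : set T) (a b : R) :
  measurable A -> measurable B -> (a%:E <= P A)%E -> (b%:E <= P B)%E ->
  ((a + b - 1)%:E <= P (A `&` B))%E.
Proof.
move=> mA mB; have mAB := measurableI _ _ mA mB.
have mU := measurableU _ _ mA mB.
have fin D : measurable D -> exists x, P D = x%:E.
  by move=> mD; exists (fine (P D)); rewrite fineK // fin_num_measure.
have U : (P (A `|` B) = P A + P B - P (A `&` B))%E.
  apply: measureUfinr => //.
  by rewrite (le_lt_trans (probability_le1 P mB)) // ltry.
have U1 : (P (A `|` B) <= 1)%E := probability_le1 P mU.
move: U1; rewrite U.
have [[x ->] [y ->] [z ->]] := And3 (fin _ mA) (fin _ mB) (fin _ mAB).
by rewrite -EFinD !lee_fin; lra.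
Qed.

End gaussian.

Section filtration.
Context {R : realType} {disp : measure_display} {T : measurableType disp}.
Context {n d m : nat} (Q : nat -> T -> 'M[R]_(n, d)).

Definition sketch_entry (kij : nat * ('I_n * 'I_d)) (w : T) : R :=
  Q kij.1 w kij.2.1 kij.2.2.

Definition past k : set (set T) :=
  generators sketch_entry [set kij | (kij.1 < k)%N].

Definition present k : set (set T) :=
  generators sketch_entry [set kij | kij.1 = k].

Lemma measurable_mx_past_next k p q (X : T -> 'M[R]_(p, q)) :
  measurable_mx (X : g_sigma_algebraType (past k) -> _) ->
  measurable_mx (X : g_sigma_algebraType (past k.+1) -> _).
Proof.
move=> mX i j _ B mB; have := mX i j measurableT B mB.
apply: sub_sigma_algebra2; apply: bigcup_subset => kij /= h.
exact: leqW.
Qed.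

Lemma measurable_mx_sketch_past k :
  measurable_mx (Q k : g_sigma_algebraType (past k.+1) -> _).
Proof.
move=> i j _ B mB; apply: sub_sigma_algebra.
by exists (k, (i, j)) => //=; exists B.
Qed.

Lemma measurable_mx_sketch_present k :
  measurable_mx (Q k : g_sigma_algebraType (present k) -> _).
Proof.
move=> i j _ B mB; apply: sub_sigma_algebra.
by exists (k, (i, j)) => //=; exists B.
Qed.

Context {f : 'cV[R]_n -> R} (f_cont : continuous f).
Context (beta c M1 M2 : R) (e : nat -> R) (x0 : 'cV[R]_n) (H0 : 'M[R]_m).
Context (Pinit : 'M[R]_(n, m)) (x : nat -> T -> 'cV[R]_n).
Context (H : nat -> T -> 'M[R]_m).

Let win k w := window (f := f) e Pinit (Q ^~ w) (x ^~ w) k.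

(** The window belongs to the state: together with [x k] and [H k] it
    determines the next state from the sketch [Q k] and the matrix [W k]. *)
Lemma measurable_run k : M1 <= M2 -> fd_run f beta c M1 M2 e x0 H0 Pinit Q x H ->
  [/\ measurable_mx (x k : g_sigma_algebraType (past k) -> _),
      measurable_mx (H k : g_sigma_algebraType (past k) -> _) &
      measurable_mx (win k : g_sigma_algebraType (past k) -> _)].
Proof.
move=> M12 [W [aW sW path]]; elim: k => [|k [mx mH mW]].
  have x0E w : x 0%N w = x0 by have [] := path w.
  have H0E w : H 0%N w = H0 by have [] := path w.
  split=> i j.
  - by under eq_fun do rewrite x0E; exact: measurable_cst.
  - by under eq_fun do rewrite H0E; exact: measurable_cst.
  - exact: measurable_cst.
have {}mx := measurable_mx_past_next mx.
have {}mH := measurable_mx_past_next mH.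
have {}mW := measurable_mx_past_next mW.
have mQ := @measurable_mx_sketch_past k.
have mA : measurable_mx (win k.+1 : g_sigma_algebraType (past k.+1) -> _).
  rewrite /win /window; under eq_fun do rewrite proj_mxE.
  apply: measurable_push_cols => //; first exact: measurable_normalize.
  apply: measurable_normalize; apply: measurable_mxM => //.
  exact: measurable_fdgrad.
have mWk : measurable_mx (W k : g_sigma_algebraType (past k.+1) -> _).
  (* [history Q k] and [<<s past Q k.+1 >>] are convertible. *)
  by move=> i j _ B mB; rewrite setTI; exact: aW.
have step w : fd_step f beta c M1 M2 (e k) (win k.+1 w) (W k w) (x k w)
    (H k w) (x k.+1 w) (H k.+1 w) by have [_ _ /(_ k)] := path w.
by have [] := measurable_fd_step f_cont M12 mA mWk mx mH step.
Qed.

End filtration.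

Section one_step_expectation.
Context {R : realType} {disp : measure_display} {T : measurableType disp}.
Context {P : probability T R} {n d : nat} {Q : nat -> T -> 'M[R]_(n, d)}.
Context (hQ : gaussian_mx_seq P Q).

Lemma gaussian_mx_seq_nth k : gaussian_mx P (Q k).
Proof.
have [nQ iQ] := hQ; split=> [ij|s B us mB]; first exact: (nQ (k, ij)).
have := iQ [seq (k, ij) | ij <- s] (fun kij => B kij.2).
rewrite map_inj_uniq => [|ij kl [] //] /(_ us (fun kij => mB kij.2)).
rewrite big_map /= => <-; congr (P _); apply/seteqP; split=> w /= h.
  by move=> [l ij] /= /mapP[kl skl [-> ->]]; exact: h.
by move=> ij sij; apply: (h (k, ij)); rewrite /= map_f.
Qed.

Lemma measurable_sketch_entry kij : measurable_fun setT (sketch_entry Q kij).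
Proof. by have [/(_ kij)[]] := hQ. Qed.

Lemma past_measurable k : <<s past Q k >> `<=` measurable.
Proof. by have := generators_measurable measurable_sketch_entry; apply. Qed.

Lemma present_measurable k : <<s present Q k >> `<=` measurable.
Proof. by have := generators_measurable measurable_sketch_entry; apply. Qed.

Lemma indep_past_present k A B : <<s past Q k >> A -> <<s present Q k >> B ->
  P (A `&` B) = (P A * P B)%E.
Proof.
have [_ iQ] := hQ; apply: (indep_generators measurable_sketch_entry iQ).
by move=> kij /= lk kE; rewrite kE ltnn in lk.
Qed.

Lemma measurable_fun_past k d' (U : measurableType d') (g : T -> U) :
  measurable_fun setT (g : g_sigma_algebraType (past Q k) -> U) ->
  measurable_fun setT g.
Proof.
move=> mg _ B mB; have := mg measurableT B mB; rewrite !setTI.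
exact: past_measurable.
Qed.

(** The decrease happens on the event [S], whose conditional probability given
    the past is at least [p]; [indep_integral_ge] averages it. *)
Lemma expectation_decrease k (D D' Y : T -> R)
    (S : set (g_sigma_algebraType (past Q k) *
              g_sigma_algebraType (present Q k))) (kap p : R) :
  measurable_fun setT D -> measurable_fun setT D' ->
  measurable_fun setT (Y : g_sigma_algebraType (past Q k) -> R) ->
  measurable S ->
  (forall w, 0 <= D' w) -> (forall w, 0 <= Y w) -> 0 <= kap -> 0 <= p ->
  (forall w, p%:E <= P [set w' | S (w, w')])%E ->
  (forall w, D' w <= D w - kap * (Y w * \1_S (w, w))) ->
  ('E_P[D'] + kap%:E * (p%:E * 'E_P[Y]) <= 'E_P[D])%E.
Proof.
move=> mD mD' mY mS D'0 Y0 kap0 p0 hp h; rewrite !expectation.unlock.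
have mYT := measurable_fun_past mY.
have mYE : measurable_fun setT
    (EFin \o Y : g_sigma_algebraType (past Q k) -> \bar R).
  exact/measurable_EFinP.
have key := @indep_integral_ge _ _ _ P (past Q k) (present Q k)
  (@past_measurable k) (@present_measurable k) (@indep_past_present k)
  (EFin \o Y) S p mYE (fun w => Y0 w) mS p0 hp.
apply: (@le_trans _ _ (\int[P]_w (D' w)%:E +
    kap%:E * \int[P]_w ((Y w)%:E * (\1_S (w, w))%:E))%E).
  by rewrite leeD2l // lee_wpmul2l.
have mdiag : measurable_fun setT (fun w : T => ((w, w) :
    g_sigma_algebraType (past Q k) * g_sigma_algebraType (present Q k))).
  apply: measurable_fun_pair.
    by move=> _ B mB; rewrite setTI; exact: past_measurable mB.
  by move=> _ B mB; rewrite setTI; exact: present_measurable mB.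
have mi : measurable_fun setT (fun w : T => \1_S (w, w) : R).
  exact: (measurableT_comp (measurable_indic mS) mdiag).
have mYi : measurable_fun setT (fun w : T => ((Y w)%:E * (\1_S (w, w))%:E)%E).
  by apply: emeasurable_funM; apply/measurable_EFinP.
have Yi0 w : (0 <= (Y w)%:E * (\1_S (w, w))%:E)%E.
  by rewrite mule_ge0 // ?lee_fin.
rewrite -ge0_integralZl //.
rewrite -ge0_integralD //; first last.
- exact: measurable_funeM.
- by move=> w _; rewrite mule_ge0 // ?lee_fin.
- exact/measurable_EFinP.
- by move=> w _; rewrite lee_fin.
apply: ge0_le_integral => //.
- by move=> w _; rewrite adde_ge0 ?mule_ge0 ?lee_fin.
- apply: emeasurable_funD; first exact/measurable_EFinP.
  exact: measurable_funeM.
- exact/measurable_EFinP.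
by move=> w _; rewrite -!EFinM -EFinD lee_fin; have := h w; lra.
Qed.

Lemma integral_probability_cst (r : R) : (\int[P]_w (cst r%:E w) = r%:E)%E.
Proof.
rewrite integral_cst // -[X in (_ * X)%E]/(P setT).
by rewrite probability_setT mule1.
Qed.

Lemma bounded_expectation (D : T -> R) (B : R) : measurable_fun setT D ->
  (forall w, 0 <= D w <= B) -> exists2 a, 'E_P[D]%E = a%:E & 0 <= a <= B.
Proof.
move=> mD DB; rewrite expectation.unlock.
have i0 : (0 <= \int[P]_w (D w)%:E)%E.
  by apply: integral_ge0 => w _; rewrite lee_fin; have /andP[] := DB w.
have iB : (\int[P]_w (D w)%:E <= B%:E)%E.
  have -> : B%:E = (\int[P]_w (cst B%:E w))%E.
    by rewrite integral_probability_cst.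
  apply: ge0_le_integral => //.
  - by move=> w _; rewrite lee_fin; have /andP[] := DB w.
  - exact/measurable_EFinP.
  - by move=> w _; rewrite lee_fin; have /andP[] := DB w.
move: i0 iB; case: (\int[P]_w _)%E => [a||] // a0 aB.
by exists a => //; rewrite -!lee_fin a0.
Qed.

(** Jensen's inequality for the square of the positive part, in the form of its
    supporting lines [z ^ 2 >= 2 t z - t ^ 2]. *)
Lemma expectation_sqr_pos_ge (D : T -> R) (B b t a y : R) : measurable_fun setT D ->
  (forall w, 0 <= D w <= B) -> 0 <= b -> 0 <= t ->
  'E_P[D]%E = a%:E -> 'E_P[fun w => (Num.max 0 (D w - b) ^+ 2)%R]%E = y%:E ->
  2 * t * (a - b) - t ^+ 2 <= y.
Proof.
move=> mD DB b0 t0; rewrite !expectation.unlock => Ea Ey.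
have mY : measurable_fun setT (fun w => (Num.max 0 (D w - b) ^+ 2)%:E).
  apply/measurable_EFinP; apply: measurable_funX; apply: measurable_maxr => //.
  exact: measurable_funB.
have D0 w : 0 <= D w by have /andP[] := DB w.
have c0 : 0 <= 2 * t * b + t ^+ 2 by rewrite addr_ge0 ?mulr_ge0 ?sqr_ge0.
have t20 : 0 <= 2 * t by rewrite mulr_ge0.
have : ((2 * t)%:E * \int[P]_w (D w)%:E <=
   \int[P]_w (Num.max 0 (D w - b) ^+ 2)%:E + (2 * t * b + t ^+ 2)%:E)%E.
  have -> : (2 * t * b + t ^+ 2)%:E = (\int[P]_w (cst (2 * t * b + t ^+ 2)%:E w))%E.
    by rewrite integral_probability_cst.
  rewrite -ge0_integralD //; last first.
    by move=> w _; rewrite lee_fin sqr_ge0.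
  rewrite -ge0_integralZl //; first last.
  - by move=> w _; rewrite lee_fin.
  - exact/measurable_EFinP.
  apply: ge0_le_integral => //.
  - by move=> w _; rewrite -EFinM lee_fin mulr_ge0.
  - by apply/measurable_EFinP; apply: measurable_funM.
  - exact: emeasurable_funD.
  move=> w _; rewrite -EFinM -EFinD lee_fin.
  have := sqr_ge0 (Num.max 0 (D w - b) - t).
  have : D w - b <= Num.max 0 (D w - b) by rewrite le_max lexx orbT.
  move: (Num.max _ _) => z zD.
  have : t * (D w - b) <= t * z by rewrite ler_wpM2l.
  by rewrite !expr2; lra.
by rewrite Ea Ey -EFinM -EFinD lee_fin; lra.
Qed.

End one_step_expectation.

(** * Scalar recursions *)

Section recursions.
Context {R : realType} (u b : nat -> R) (th : R).
Context (th_gt0 : 0 < th).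
Context (rec : forall k,
  u k.+1 <= u k - th * Num.max 0 (u k - b k) ^+ 2).

Lemma recursion_nincr k : u k.+1 <= u k.
Proof. by apply: le_trans (rec k) _; rewrite gerBl mulr_ge0 ?sqr_ge0 // ltW. Qed.

(** [z - th z ^ 2 <= z / (1 + th z)], and the right-hand side increases with
    [z]; along [z k = z0 / (1 + k th z0)] it is the next term. *)
Lemma recursion_constant_error z0 r k : 0 < z0 -> (forall k, b k = r) ->
  u 0%N - r <= z0 -> u k - r <= z0 / (1 + k%:R * (th * z0)).
Proof.
move=> z00 br u0; elim: k => [|k IH]; first by rewrite mul0r addr0 divr1.
have tz : 0 < th * z0 by rewrite mulr_gt0.
have d0 j : 0 < 1 + j%:R * (th * z0).
  by rewrite ltr_wpDr // mulr_ge0 // ltW.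
set z := z0 / (1 + k%:R * (th * z0)) in IH.
have zp : 0 < z by rewrite divr_gt0.
have E : z0 / (1 + k.+1%:R * (th * z0)) = z / (1 + th * z).
  rewrite /z -natr1; have := d0 k; have := d0 k.+1; rewrite -natr1 => h1 h2.
  field; rewrite !gt_eqF //=.
  by move: h1; congr (_ < _); ring.
rewrite E; have tz1 : 0 < 1 + th * z by rewrite ltr_wpDr // mulr_ge0 // ltW.
have [h|h] := leP (u k - r) 0.
  have := recursion_nincr k; have : 0 < z / (1 + th * z) by rewrite divr_gt0.
  by lra.
have := rec k; rewrite br (max_idPr (ltW h)) => rk.
set y := u k - r in IH h rk.
have ty : 0 < 1 + th * y by rewrite ltr_wpDr // mulr_ge0 // ltW.
apply: (@le_trans _ _ (y - th * y ^+ 2)); first by rewrite /y in rk *; lra.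
apply: (@le_trans _ _ (y / (1 + th * y))).
  rewrite ler_pdivlMr //.
  have : 0 <= th ^+ 2 * y ^+ 3 by rewrite mulr_ge0 ?exprn_ge0 // ltW.
  by rewrite !exprS !expr0; lra.
rewrite ler_pdivrMr // mulrAC ler_pdivlMr //.
lra.
Qed.

(** If [u k <= A / k] but [u k > A / k.+1], then [u k - b k] is at least
    [A / (4 k)], and the quadratic decrease exceeds [A / k - A / k.+1]. *)
Lemma recursion_decaying_error B k0 : 0 <= B -> (0 < k0)%N ->
  (forall k, (k0 <= k)%N -> b k <= B / k%:R) -> (forall k, 0 <= u k) ->
  exists A, forall k, (k0 <= k)%N -> u k <= A / k%:R.
Proof.
move=> B0 k00 bB u0.
exists (4 * B + 16 / th + k0%:R * u k0); set A : R := _ + _ + _.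
have A0 : 0 < A.
  rewrite /A; have : 0 < 16 / th by rewrite divr_gt0.
  have : 0 <= k0%:R * u k0 by rewrite mulr_ge0.
  by lra.
have A1 : 4 * B <= A.
  rewrite /A; have : 0 < 16 / th by rewrite divr_gt0.
  have : 0 <= k0%:R * u k0 by rewrite mulr_ge0.
  by lra.
have A2 : 16 <= th * A.
  have -> : 16 = th * (16 / th) :> R by field; rewrite gt_eqF.
  rewrite ler_pM2l // /A; have : 0 <= k0%:R * u k0 by rewrite mulr_ge0.
  by lra.
have A3 : k0%:R * u k0 <= A.
  rewrite /A; have : 0 < 16 / th by rewrite divr_gt0.
  by lra.
clearbody A.
move=> k kk0; rewrite -(subnK kk0); elim: (k - k0)%N => [|j IH].
  by rewrite add0n ler_pdivlMr ?ltr0n // mulrC.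
rewrite addSn; set i := (j + k0)%N in IH *.
have i1 : 1 <= i%:R :> R by rewrite ler1n /i (leq_trans k00) // leq_addl.
have bi : b i <= B / i%:R by apply: bB; rewrite leq_addl.
have [h|h] := leP (u i) (A / i.+1%:R).
  exact: le_trans (recursion_nincr i) h.
have i0 : 0 < i%:R :> R by lra.
have i2 : 0 < i.+1%:R :> R by rewrite ltr0n.
have h1 : A / (2 * i%:R) <= A / i.+1%:R.
  rewrite ler_pM2l // lef_pV2 ?posrE ?mulr_gt0 //; rewrite -natr1; lra.
have h2 : B / i%:R <= A / (4 * i%:R).
  rewrite ler_pdivrMr // mulrAC ler_pdivlMr ?mulr_gt0 //.
  by have := ler_wpM2r (ltW i0) A1; lra.
have h3 : A / (4 * i%:R) = A / (2 * i%:R) / 2 by field; rewrite gt_eqF.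
have h4 : A / (4 * i%:R) <= u i - b i.
  move: h1 h2 h3 h bi; move: (A / (4 * i%:R)) (A / (2 * i%:R)) (B / i%:R).
  by move: (A / i.+1%:R) => *; lra.
have h5 : 0 <= A / (4 * i%:R) by rewrite divr_ge0 // ltW // mulr_gt0.
have := rec i; rewrite max_r; last by lra.
have h6 : (A / (4 * i%:R)) ^+ 2 <= (u i - b i) ^+ 2.
  by rewrite ler_sqr ?nnegrE //; lra.
have h7 := ler_wpM2l (ltW th_gt0) h6.
have h8 : A / i%:R - A / i.+1%:R <= th * (A / (4 * i%:R)) ^+ 2.
  have -> : A / i%:R - A / i.+1%:R = A / (i%:R * i.+1%:R).
    by rewrite -natr1; field; rewrite !gt_eqF //=; lra.
  have -> : th * (A / (4 * i%:R)) ^+ 2 = (th * A / 16) * (A / (i%:R * i%:R)).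
    by field; rewrite gt_eqF.
  apply: (@le_trans _ _ (A / (i%:R * i%:R))).
    by rewrite ler_pM2l // lef_pV2 ?posrE ?mulr_gt0 // ler_pM2l // ler_nat.
  by rewrite ler_peMl // ?divr_ge0 ?mulr_ge0 ?(ltW A0) //; lra.
move: h7 h8 IH; move: (A / i%:R) (A / i.+1%:R) (th * (A / _) ^+ 2).
by move: (th * (u i - b i) ^+ 2) => *; lra.
Qed.

End recursions.

(** * Convergence rate *)

Section success.
Context {R : realType} {disp : measure_display} {T : measurableType disp}.
Context {P : probability T R} {n d : nat}.

Definition successful (s eps : R) (v : 'cV[R]_n) (A : 'M[R]_(n, d)) : bool :=
  ((1 - eps) * d%:R * enorm v ^+ 2 <= enorm (A^T *m v) ^+ 2)
  && (opnorm (A *m A^T) <= s).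

Lemma measurable_successful {d'} {U : measurableType d'} s eps
    (v : U -> 'cV[R]_n) (A : U -> 'M[R]_(n, d)) :
  measurable_mx v -> measurable_mx A ->
  measurable [set w | successful s eps (v w) (A w)].
Proof.
move=> mv mA; have mAT := measurable_mxT mA.
apply: measurable_pred; apply: measurable_and; apply: measurable_fun_ler => //.
- apply: measurable_funM => //; apply: measurable_funX.
  exact: measurable_enorm.
- apply: measurable_funX; apply: measurable_enorm; exact: measurable_mxM.
- by apply: measurable_opnorm; exact: measurable_mxM.
Qed.

(** The concentration inequality for [eps] and the bound on the Gram matrix
    fail with total probability at most [1 - success_prob d C0 eps]. *)
Lemma probability_successful (Q : T -> 'M[R]_(n, d)) C0 C eps v :
  (0 < d)%N -> gaussian_mx P Q -> concentration_constants P n d C0 C ->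
  0 < eps < 1 ->
  ((success_prob d C0 eps)%:E <=
    P [set w | successful (C * n%:R) eps v (Q w)])%E.
Proof.
move=> d0 gQ hC he; have [/(_ eps v he) h1 h2] := hC Q gQ.
have dp : 0 < d%:R :> R by rewrite ltr0n.
have mQ : measurable_mx Q by have [nQ _] := gQ => i j; have [] := nQ (i, j).
have mQT := measurable_mxT mQ.
have m1 : measurable [set w | ((1 - eps) * enorm v ^+ 2
    <= enorm ((Num.sqrt d%:R)^-1 *: ((Q w)^T *m v)) ^+ 2
    <= (1 + eps) * enorm v ^+ 2)%R].
  have mE : measurable_fun setT
      (fun w => enorm ((Num.sqrt d%:R)^-1 *: ((Q w)^T *m v)) ^+ 2).
    apply: measurable_funX; apply: measurable_enorm; apply: measurable_mxZ => //.
    exact: measurable_mxM.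
  by apply: measurable_pred; apply: measurable_and; apply: measurable_fun_ler.
have m2 : measurable [set w |
    (d%:R^-1 * opnorm (Q w *m (Q w)^T) <= C * (n%:R / d%:R))%R].
  apply: measurable_pred; apply: measurable_fun_ler => //.
  by apply: measurable_funM => //; apply: measurable_opnorm; exact: measurable_mxM.
have h := probability_setI_ge m1 m2 h1 h2.
have hp : ((success_prob d C0 eps)%:E <=
    (1 - 2 * expR (- (C0 * eps ^+ 2 * d%:R)) + (1 - 2 * expR (- d%:R)) - 1)%:E)%E.
  by rewrite lee_fin /success_prob; lra.
apply: le_trans hp (le_trans h _).
apply: le_measure; rewrite ?inE; [exact: measurableI|exact: measurable_successful|].
move=> w /= [/andP[+ _] +]; rewrite /successful enormZ exprMn.
rewrite real_normK ?num_real // exprVn (sqr_sqrtr (ler0n R d)) => k1 k2.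
apply/andP; split; first by rewrite mulrAC -ler_pdivlMr // [X in _ <= X]mulrC.
by move: k2; rewrite mulrA mulrC ler_pM2r // invr_gt0.
Qed.

End success.

Section rate.
Context (R : realType) (n d m : nat).
Context (hd : (0 < d)%N) (hm : (0 < m)%N) (hm2 : ~~ odd m).
Context (hdn : (d < n)%N).
Context (f : 'cV[R]_n -> R) (hf2 : class_C2 f).
Context (fstar : R) (hfstar : optimal_value f = fstar%:E).
Context (beta c M1 M2 : R) (hbeta : 0 < beta < 1) (hc : 0 < c < 1).
Context (hM1 : 0 < M1) (hM12 : M1 <= M2).
Context (H0 : 'M[R]_m) (hH0 : spectral_bounds M1 M2 H0).
Context (Pinit : 'M[R]_(n, m)) (hPinit : forall j, enorm (col j Pinit) = 1).
Context (disp : measure_display) (T : measurableType disp).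
Context (P : probability T R).
Context (Q : nat -> T -> 'M[R]_(n, d)) (hQ : gaussian_mx_seq P Q).
Context (C0 C : R) (hC : 0 < C) (hconc : concentration_constants P n d C0 C).
Context (hc2 : c < 1 / 2) (L : R) (hL : 0 < L).
Context (hLip : forall u v : 'cV[R]_n,
  enorm (grad f u - grad f v) <= L * enorm (u - v)).
Context (hconv : convex_function setT f).
Context (x0 : 'cV[R]_n) (R0 : R) (hR0 : sublevel_radius f x0 = R0%:E).
Context (eps : R) (heps : 0 < eps < 1) (hp : 0 < success_prob d C0 eps).
Context (e : nat -> R) (e_gt0 : forall k, 0 < e k).
Context (x : nat -> T -> 'cV[R]_n) (H : nat -> T -> 'M[R]_m).
Context (run : fd_run f beta c M1 M2 e x0 H0 Pinit Q x H).

Let f_partial : forall i y, derivable f y (delta_mx i 0).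
Proof. by move=> i y; have [/(_ i)[]] := hf2. Qed.

Let f_cont : continuous f.
Proof. exact: continuous_lipschitz_grad f_partial hLip. Qed.

Let s : R := C * n%:R.
Let K : R := Num.max (4 * Num.sqrt d%:R * C * n%:R / (1 - eps))
  (6 * C * n%:R * m%:R ^+ 2 / d%:R * (M2 / (M1 * c) + 1)) * L.
Let abar : R := Num.min 1 (2 * beta * (1 - 2 * c) / (m%:R * M2 * L)).
Let kap : R := c * abar * M1 * ((1 - eps) * d%:R / s) ^+ 2 / R0 ^+ 2.
Let gap k w := f (x k w) - fstar.

Let m_gt1 : (1 < m)%N.
Proof. by case: m hm hm2 => [|[|]]. Qed.

Let M2_gt0 : 0 < M2. Proof. exact: lt_le_trans hM12. Qed.

Let n_gt0 : (0 < n)%N. Proof. exact: leq_trans hdn. Qed.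

Let s_gt0 : 0 < s. Proof. by rewrite mulr_gt0 // ltr0n. Qed.

Let s_lb : 1 / 96 <= s.
Proof.
have gQ := gaussian_mx_seq_nth hQ 0.
have [_ h] := hconc gQ.
apply: (gram_constant_lb (Ordinal n_gt0) (Ordinal hd) (ltW s_gt0) gQ).
apply: le_trans h _; rewrite le_eqVlt; apply/orP; left; apply/eqP.
congr (P _); apply/seteqP; split=> w /=; rewrite mulrA mulrC ler_pM2r //.
all: by rewrite invr_gt0 ltr0n.
Qed.

Let K1 : 4 * Num.sqrt d%:R * s / (1 - eps) * L <= K.
Proof. by rewrite /K ler_pM2r // le_max /s mulrA lexx. Qed.

Let K2 : 6 * s * m%:R ^+ 2 / d%:R * (M2 / (M1 * c) + 1) * L <= K.
Proof. by rewrite /K ler_pM2r // le_max /s mulrA lexx orbT. Qed.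

Let K_gt0 : 0 < K.
Proof.
apply: lt_le_trans K1; have [_ e1] := andP heps.
have d1 := sqrtr_gt0 (d%:R : R).
apply: mulr_gt0 => //; apply: divr_gt0; last by lra.
by rewrite mulr_gt0 // mulr_gt0 // d1 ltr0n.
Qed.

Let abar_gt0 : 0 < abar.
Proof.
have [b0 _] := andP hbeta.
rewrite lt_min ltr01 divr_gt0 // !mulr_gt0 ?ltr0n //; have := hc2; lra.
Qed.

Let run_step w k : exists W, spectral_bounds M1 M2 W /\
  fd_step f beta c M1 M2 (e k)
    (proj_mx f e Pinit (Q ^~ w) (x ^~ w) k) W (x k w) (H k w)
    (x k.+1 w) (H k.+1 w).
Proof.
have [W [_ sW path]] := run; exists (W k w); split; first exact: sW.
by have [_ _ /(_ k)] := path w.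
Qed.

Let run_x0 w : x 0%N w = x0.
Proof. by have [W [_ _ /(_ w)[]]] := run. Qed.

Let run_spectral k w : spectral_bounds M1 M2 (H k w).
Proof.
elim: k => [|k IH]; last first.
  by have [W [sW st]] := run_step w k; exact: fd_step_spectral st.
by have [W [_ _ /(_ w)[_ -> _]]] := run.
Qed.

Lemma gap_nincr k w : gap k.+1 w <= gap k w.
Proof.
have [c0 _] := andP hc; have [b0 _] := andP hbeta.
have [W [sW st]] := run_step w k.
by rewrite lerD2r; exact: fd_step_le b0 c0 (ltW hM1) (run_spectral k w) st.
Qed.

Let run_sublevel k w : f (x k w) <= f x0.
Proof.
elim: k => [|k IH]; first by rewrite run_x0.
by apply: le_trans IH; have := gap_nincr k w; rewrite lerD2r.
Qed.

Lemma gap_bounds k w : 0 <= gap k w <= L / 2 * R0 ^+ 2.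
Proof.
rewrite subr_ge0 (optimal_value_le _ hfstar) /=.
exact: (gap_le_radius f_partial hLip hL hfstar hR0).
Qed.

(** Convexity turns [gap > 2 R0 K e] into [|grad f| > 2 K e], so that
    [fd_step_decrease] applies, and [R0 (|grad f| - 2 K e)] is at least the
    excess of the gap. *)
Lemma gap_decrease k w : 0 < R0 ->
  successful s eps (grad f (x k w)) (Q k w) ->
  gap k.+1 w <= gap k w - kap * Num.max 0 (gap k w - 2 * R0 * K * e k) ^+ 2.
Proof.
move=> R00 /andP[good Qs].
have [h|h] := leP (gap k w - 2 * R0 * K * e k) 0.
  by rewrite expr0n mulr0 subr0; exact: gap_nincr.
have gR := gap_le_grad f_partial hLip hconv hfstar hR0 (run_sublevel k w).
set del := enorm (grad f (x k w)) in gR good.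
have delK : 2 * K * e k < del.
  rewrite -(ltr_pM2l R00); move: h gR; rewrite /gap; lra.
have [W [sW st]] := run_step w k.
have cols j : enorm (col j (proj_mx f e Pinit (Q ^~ w) (x ^~ w) k)) <= 1.
  by apply: proj_mx_col_le1 => i; rewrite hPinit.
have last := proj_mx_last (f := f) e Pinit (Q ^~ w) (x ^~ w) k hm.
have hcc : 0 < c < 1 / 2 by have [c0 _] := andP hc; rewrite c0.
have dec := fd_step_decrease f_partial hLip hd m_gt1 hL hbeta hcc hM1 M2_gt0
  (e_gt0 k) heps s_lb K1 K2 (run_spectral k w) cols last st Qs good delK.
rewrite -/abar -/del in dec.
have ex : (gap k w - 2 * R0 * K * e k) / R0 <= del - 2 * K * e k.
  rewrite ler_pdivrMr //; move: gR; rewrite /gap; lra.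
have ex0 : 0 <= (gap k w - 2 * R0 * K * e k) / R0 by rewrite divr_ge0 // ltW.
have ex2 : ((gap k w - 2 * R0 * K * e k) / R0) ^+ 2 <= (del - 2 * K * e k) ^+ 2.
  by rewrite ler_sqr ?nnegrE // (le_trans ex0).
have [c0 _] := andP hc.
have q0 : 0 <= c * abar * M1 * ((1 - eps) * d%:R / s) ^+ 2.
  by rewrite mulr_ge0 ?sqr_ge0 // !mulr_ge0 ?(ltW c0) ?(ltW abar_gt0) ?(ltW hM1).
have {ex ex0} ex3 := ler_wpM2l q0 ex2.
rewrite /kap; move: (c * abar * M1 * _) q0 dec ex3 => q q0 dec ex3.
rewrite mulrAC -mulrA -expr_div_n.
by apply: (@le_trans _ _ (gap k w - q * (del - 2 * K * e k) ^+ 2));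
  rewrite ?lerD2l ?lerN2 // /gap; lra.
Qed.

Lemma measurable_gap k :
  measurable_fun setT (gap k : g_sigma_algebraType (past Q k) -> R).
Proof.
have [mx _ _] := measurable_run f_cont k hM12 run.
by apply: measurable_funB => //; exact: measurable_mx_continuous.
Qed.

Lemma measurable_gapT k : measurable_fun setT (gap k).
Proof. exact: (measurable_fun_past hQ (@measurable_gap k)). Qed.

Lemma gap_expectation k :
  exists2 a, 'E_P[gap k]%E = a%:E & 0 <= a <= L / 2 * R0 ^+ 2.
Proof. exact: bounded_expectation (@measurable_gapT k) (gap_bounds k). Qed.

Let u k : R := fine 'E_P[gap k]%E.

Lemma gap_expectationE k : 'E_P[gap k]%E = (u k)%:E.
Proof. by rewrite /u; have [a -> _] := gap_expectation k. Qed.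

Lemma u_bounds k : 0 <= u k <= L / 2 * R0 ^+ 2.
Proof. by rewrite /u; have [a -> h] := gap_expectation k. Qed.

Let p := success_prob d C0 eps.

Let kap_gt0 : 0 < R0 -> 0 < kap.
Proof.
move=> R00; have [c0 _] := andP hc; have [_ e1] := andP heps.
have q0 : 0 < (1 - eps) * d%:R / s.
  by rewrite divr_gt0 // mulr_gt0 ?ltr0n //; lra.
by rewrite divr_gt0 ?exprn_gt0 // mulr_gt0 ?exprn_gt0 // !mulr_gt0.
Qed.

(** The gap and the gradient at step [k] are functions of the past, on which
    the current sketch does not depend; given the past, [gap_decrease] thus
    applies with probability at least [p]. *)
Lemma expected_gap_decrease k : 0 < R0 ->
  u k.+1 <= u k - kap * p * Num.max 0 (u k - 2 * R0 * K * e k) ^+ 2.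
Proof.
move=> R00; set b := 2 * R0 * K * e k.
have b0 : 0 <= b.
  by rewrite mulr_ge0 ?(ltW (e_gt0 k)) // mulr_ge0 ?(ltW K_gt0) // mulr_ge0 // ltW.
pose Y w := Num.max 0 (gap k w - b) ^+ 2.
pose S : set (g_sigma_algebraType (past Q k) *
              g_sigma_algebraType (present Q k)) :=
  [set z | successful s eps (grad f (x k z.1)) (Q k z.2)].
have mY : measurable_fun setT (Y : g_sigma_algebraType (past Q k) -> R).
  apply: measurable_funX; apply: measurable_maxr => //.
  by apply: measurable_funB => //; exact: measurable_gap.
have mS : measurable S.
  have [mx _ _] := measurable_run f_cont k hM12 run.
  apply: measurable_successful => i j.
    apply: (measurableT_comp (f := fun w : g_sigma_algebraType (past Q k) =>
      grad f (x k w) i j)) => //.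
    under eq_fun do rewrite mxE.
    by apply: measurable_mx_continuous => //; have [/(_ i)[]] := hf2.
  apply: (measurableT_comp (f := fun w : g_sigma_algebraType (present Q k) =>
      Q k w i j)) => //.
  exact: measurable_mx_sketch_present.
have pS w : (p%:E <= P [set w' | S (w, w')])%E.
  pose proof (probability_successful (grad f (x k w)) hd
    (gaussian_mx_seq_nth hQ k) hconc heps) as h.
  apply: (le_trans h).
  by rewrite (_ : [set w' | S (w, w')] =
    [set w' | successful s eps (grad f (x k w)) (Q k w')]).
have dec w : gap k.+1 w <= gap k w - kap * (Y w * \1_S (w, w)).
  have [Sw|Sw] := pselect (S (w, w)).
    rewrite indicE mem_set // mulr1; exact: gap_decrease.
  by rewrite indicE memNset // mulr0 mulr0 subr0 gap_nincr.
have Y0 w : 0 <= Y w by exact: sqr_ge0.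
have g0 w : 0 <= gap k.+1 w by have /andP[] := gap_bounds k.+1 w.
have := expectation_decrease hQ (@measurable_gapT k) (@measurable_gapT k.+1) mY
  mS g0 Y0 (ltW (kap_gt0 R00)) (ltW hp) pS dec.
have [y Ey /andP[y0 _]] : exists2 y, 'E_P[Y]%E = y%:E &
    0 <= y <= (L / 2 * R0 ^+ 2) ^+ 2.
  apply: bounded_expectation; first exact: (measurable_fun_past hQ mY).
  move=> w; rewrite Y0 ler_sqr ?nnegrE ?le_max ?lexx //.
    have /andP[h1 h2] := gap_bounds k w.
    by rewrite ge_max (le_trans h1 h2) /=; lra.
  by have /andP[h1 h2] := gap_bounds k w; exact: le_trans h2.
rewrite !gap_expectationE Ey -!EFinM -EFinD lee_fin -/p => h.
have [z|z] := leP (u k - b) 0.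
  rewrite expr0n mulr0 subr0.
  have : 0 <= kap * (p * y).
    by rewrite mulr_ge0 ?(ltW (kap_gt0 R00)) // mulr_ge0 // ltW.
  by lra.
have jen := expectation_sqr_pos_ge (@measurable_gapT k) (gap_bounds k) b0
  (ltW z) (gap_expectationE k) Ey.
have jen2 : (u k - b) ^+ 2 <= y by move: jen; rewrite !expr2; lra.
have kp0 : 0 <= kap * p.
  by rewrite mulr_ge0 ?(ltW (kap_gt0 R00)) // ltW.
by have := ler_wpM2l kp0 jen2; lra.
Qed.


Lemma u_eq0 k : R0 = 0 -> u k = 0.
Proof.
move=> R00; apply/le_anti; have := u_bounds k.
by rewrite R00 expr0n mulr0 andbC.
Qed.

(** [recursion_constant_error] with [z0 = L R0 ^ 2 / 2]. *)
Lemma expected_gap_rate e0 : (forall k, e k = e0) -> forall k,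
  ('E_P[gap k] <= (L * C ^+ 2 * n%:R ^+ 2 * R0 ^+ 2 /
       (2 * C ^+ 2 * n%:R ^+ 2 +
        L * c * M1 * success_prob d C0 eps * (1 - eps) ^+ 2 * d%:R ^+ 2
          * k%:R * abar)
     + 2 * R0 * K * e0)%:E)%E.
Proof.
move=> ee0 k; rewrite gap_expectationE lee_fin -/p.
have e00 : 0 < e0 by rewrite -(ee0 0%N).
have R0_ge0 := sublevel_radius_ge0 hR0.
have [R00|R0n0] := eqVneq R0 0.
  by rewrite u_eq0 // R00 expr0n /= !(mulr0, mul0r) addr0.
have R0p : 0 < R0 by rewrite lt_def R0n0.
have thp : 0 < kap * p by rewrite mulr_gt0 // kap_gt0.
have z0p : 0 < L / 2 * R0 ^+ 2 by rewrite !mulr_gt0 // invr_gt0.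
have ini : u 0%N - 2 * R0 * K * e0 <= L / 2 * R0 ^+ 2.
  have /andP[_ h] := u_bounds 0; rewrite lerBlDr (le_trans h) // lerDl.
  by rewrite mulr_ge0 ?(ltW e00) // mulr_ge0 ?(ltW K_gt0) // mulr_ge0.
have rec j : u j.+1 <= u j -
    kap * p * Num.max 0 (u j - (fun=> 2 * R0 * K * e0) j) ^+ 2.
  by have := expected_gap_decrease j R0p; rewrite ee0.
have := recursion_constant_error thp rec k z0p (fun=> erefl) ini.
rewrite lerBlDr => /le_trans; apply; rewrite lerD2r le_eqVlt; apply/orP; left.
have np : 0 < n%:R :> R by rewrite ltr0n.
have [c0 _] := andP hc; have [_ e1] := andP heps.
have dp : 0 < d%:R :> R by rewrite ltr0n.
have den : 0 <= L * c * M1 * p * (1 - eps) ^+ 2 * d%:R ^+ 2 * k%:R * abar.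
  rewrite mulr_ge0 ?(ltW abar_gt0) // mulr_ge0 // mulr_ge0 ?sqr_ge0 //.
  rewrite mulr_ge0 ?sqr_ge0 // mulr_ge0 ?(ltW hp) // mulr_ge0 ?(ltW hM1) //.
  by rewrite mulr_ge0 // ltW.
have Cn : 0 < 2 * C ^+ 2 * n%:R ^+ 2 by rewrite !mulr_gt0 // exprn_gt0.
apply/eqP; rewrite /kap /s; move: den Cn abar_gt0 hp; rewrite -/p.
move: abar p => ab pp den Cn _ _.
have q1 : 0 < 2 * C ^+ 2 * n%:R ^+ 2 +
    L * c * M1 * pp * (1 - eps) ^+ 2 * d%:R ^+ 2 * k%:R * ab.
  by rewrite ltr_wpDr.
field.
by rewrite !gt_eqF.
Qed.

Lemma expected_gap_decay : e =O_\oo (fun k : nat => k%:R^-1 : R) ->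
  u =O_\oo (fun k : nat => k%:R^-1 : R).
Proof.
move=> /eqO_exP[B0 B0p [k0 _ eB]]; apply/eqO_exP.
suff [A [k1 uA]] : exists A k1, forall k, (k1 <= k)%N -> u k <= A / k%:R.
  exists (`|A| + 1); first by rewrite ltr_wpDl.
  exists k1 => // k /= k1k; rewrite ger0_norm; last by have /andP[] := u_bounds k.
  apply: le_trans (uA k k1k) _.
  rewrite [`|_^-1|]ger0_norm ?invr_ge0 // ler_wpM2r ?invr_ge0 //.
  by rewrite (le_trans (ler_norm _)) // lerDl.
have R0_ge0 := sublevel_radius_ge0 hR0.
have [R00|R0n0] := eqVneq R0 0.
  by exists 0, 0%N => k _; rewrite u_eq0 // mul0r.
have R0p : 0 < R0 by rewrite lt_def R0n0.
have thp : 0 < kap * p by rewrite mulr_gt0 // kap_gt0.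
have c0 : 0 <= 2 * R0 * K by rewrite mulr_ge0 ?(ltW K_gt0) // mulr_ge0.
have [||k kk|k|A uA] := recursion_decaying_error thp
    (fun k => expected_gap_decrease k R0p) (B := 2 * R0 * K * B0) (k0 := maxn k0 1).
- by rewrite mulr_ge0 // ltW.
- by rewrite leq_max orbT.
- rewrite -[2 * R0 * K * B0 / _]mulrA ler_wpM2l //.
  have := eB k; rewrite /= => /(_ _).
  rewrite [`|e k|]gtr0_norm // [`|_^-1|]ger0_norm ?invr_ge0 //; apply.
  by rewrite (leq_trans _ kk) // leq_maxl.
- by have /andP[] := u_bounds k.
by exists A, (maxn k0 1).
Qed.

End rate.

Theorem theorem9 (R : realType) (n d m : nat)
  (hd : (0 < d)%N) (hm : (0 < m)%N) (hm2 : ~~ odd m)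
  (hdn : (d < n)%N) (hmn : (m < n)%N)
  (f : 'cV[R]_n -> R) (hf2 : class_C2 f)
  (fstar : R) (hfstar : optimal_value f = fstar%:E)
  (beta c M1 M2 : R) (hbeta : 0 < beta < 1) (hc : 0 < c < 1)
  (hM1 : 0 < M1) (hM12 : M1 <= M2)
  (H0 : 'M[R]_m) (hH0 : spectral_bounds M1 M2 H0)
  (Pinit : 'M[R]_(n, m)) (hPinit : forall j, enorm (col j Pinit) = 1)
  (disp : measure_display) (T : measurableType disp) (P : probability T R)
  (Q : nat -> T -> 'M[R]_(n, d)) (hQ : gaussian_mx_seq P Q)
  (C0 C : R) (hC0 : 0 < C0) (hC : 0 < C)
  (hconc : concentration_constants P n d C0 C)
  (hc2 : c < 1 / 2)
  (L : R) (hL : 0 < L)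
  (hLip : forall u v : 'cV[R]_n, enorm (grad f u - grad f v) <= L * enorm (u - v))
  (hconv : convex_function setT f)
  (x0 : 'cV[R]_n) (R0 : R) (hR0 : sublevel_radius f x0 = R0%:E)
  (eps : R) (heps : 0 < eps < 1) (hp : 0 < success_prob d C0 eps) :
  (forall e : R, 0 < e ->
   forall (x : nat -> T -> 'cV[R]_n) (H : nat -> T -> 'M[R]_m),
   fd_run f beta c M1 M2 (fun=> e) x0 H0 Pinit Q x H ->
   let K : R := Num.max (4 * Num.sqrt d%:R * C * n%:R / (1 - eps))
              (6 * C * n%:R * m%:R ^+ 2 / d%:R * (M2 / (M1 * c) + 1)) * L in
   let abar : R := Num.min 1 (2 * beta * (1 - 2 * c) / (m%:R * M2 * L)) in
   forall k : nat,
   ('E_P[fun w => (f (x k w) - fstar)%R] <=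
    (L * C ^+ 2 * n%:R ^+ 2 * R0 ^+ 2 /
       (2 * C ^+ 2 * n%:R ^+ 2 +
        L * c * M1 * success_prob d C0 eps * (1 - eps) ^+ 2 * d%:R ^+ 2
          * k%:R * abar)
     + 2 * R0 * K * e)%:E)%E)
  /\
  (forall e : nat -> R, (forall k, 0 < e k) ->
   e =O_\oo (fun k : nat => k%:R^-1 : R) ->
   forall (x : nat -> T -> 'cV[R]_n) (H : nat -> T -> 'M[R]_m),
   fd_run f beta c M1 M2 e x0 H0 Pinit Q x H ->
   (forall k, 'E_P[fun w => (f (x k w) - fstar)%R]%E \is a fin_num) /\
   (fun k : nat => fine 'E_P[fun w => (f (x k w) - fstar)%R]%E)
     =O_\oo (fun k : nat => k%:R^-1 : R)).
Proof.
split=> [e e_gt0 x H run K abar k|e e_gt0 eO x H run].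
  exact: (expected_gap_rate hd hm hm2 hdn hf2 hfstar hbeta hc hM1 hM12 hH0
    hPinit hQ hC hconc hc2 hL hLip hconv hR0 heps hp (fun=> e_gt0) run
    (fun=> erefl)).
split=> [k|].
  by rewrite (gap_expectationE hf2 hfstar hbeta hc hM1 hM12 hH0 hQ hL hLip hR0
    run).
exact: (expected_gap_decay hd hm hm2 hdn hf2 hfstar hbeta hc hM1 hM12 hH0
    hPinit hQ hC hconc hc2 hL hLip hconv hR0 heps hp e_gt0 run eO).
Qed.
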